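(* Let $n\ge2$ and let $e,h,f\in\mathfrak{sl}_n(\mathbb R)$ form a standard triple. Let $\Lambda$ be the partition of $n$ such that $\mathrm{SL}_n(\mathbb C)\cdot e=\mathcal O_\Lambda$, and let $\Lambda^0$ (resp. $\Lambda^1$) be the subsequence of even (resp. odd) parts of $\Lambda$. (a) Assume that $e$ is even. Then $\mathcal L(e)=\overline{\mathcal O_\Lambda\cap\mathfrak{sl}_n(\mathbb R)}=\overline{\mathcal O_\Lambda}\cap\mathfrak{sl}_n(\mathbb R)$. (b) Assume that $e$ is not even, i.e., $\Lambda^0\neq\emptyset$ and $\Lambda^1\neq\emptyset$. Let $\Lambda^0+\Lambda^1:=(\mu^0_k+\mu^1_k)_{k=1}^{\ell}$ be the partition of $n$ obtained by summing the sequences $\Lambda^0=(\mu^0_k)_{k=1}^\ell$ and $\Lambda^1=(\mu^1_k)_{k=1}^\ell$ term by term (adding $0$'s if necessary so that both sequences have the same length $\ell$). Then $$\mathcal L(\mathcal O^{\mathbb R}_\Lambda)=\overline{\mathcal O^{\mathbb R}_{\Lambda^0+\Lambda^1}}.$$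
   Context: Let $G_{\mathbb R}=\mathrm{SL}_n(\mathbb R)$, $G=\mathrm{SL}_n(\mathbb C)$; the dot denotes the adjoint action. A standard triple ($\mathfrak{sl}_2$-triple) satisfies $[h,e]=2e$, $[h,f]=-2f$, $[e,f]=h$. The nilpotent $e$ is even if all eigenvalues of $\mathrm{ad}(h)$ are even integers. $\mathcal O_\Lambda\subset\mathfrak{sl}_n(\mathbb C)$ is the nilpotent $G$-orbit of matrices whose Jordan block sizes are the parts of the partition $\Lambda$, written in nonincreasing order (and its subsequences $\Lambda^0,\Lambda^1$ are also in nonincreasing order). If $\Lambda$ has at least one odd part, $\mathcal O_\Lambda\cap\mathfrak{sl}_n(\mathbb R)$ is a single $\mathrm{SL}_n(\mathbb R)$-orbit, denoted $\mathcal O^{\mathbb R}_\Lambda$. For $x\in\mathfrak g_{\mathbb R}=\mathfrak{sl}_n(\mathbb R)$, $$\lim_{\nu\to 0^+}G_{\mathbb R}\cdot(\nu x):=\bigcap_{\epsilon>0}\overline{\bigcup_{\nu\in(0,\epsilon)}G_{\mathbb R}\cdot(\nu x)}.$$ For $e\in\mathfrak g_{\mathbb R}$ nilpotent in an $\mathfrak{sl}_2$-triple $\{h,e,f\}\subset\mathfrak g_{\mathbb R}$, $\mathcal L(e)=\lim_{\nu\to0^+}G_{\mathbb R}\cdot(\nu h)$; it depends only on the orbit $\mathcal O=G_{\mathbb R}\cdot e$ and is also denoted $\mathcal L(\mathcal O)$. Closures of subsets of $\mathfrak{sl}_n(\mathbb R)$ are in the Euclidean topology; $\overline{\mathcal O_\Lambda}$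 is the Zariski closure in $\mathfrak{sl}_n(\mathbb C)$. *)

(* Defs.v *)
From HB Require Import structures.
From mathcomp Require Import all_boot all_order all_algebra.
From mathcomp Require Import all_classical all_reals all_analysis.
From mathcomp Require Import complex.
(* Not imported: the notations of mpoly clash with those of all_analysis. *)
From mathcomp Require mpoly.

Set Implicit Arguments.
Unset Strict Implicit.
Unset Printing Implicit Defensive.

Import Order.TTheory GRing.Theory Num.Theory.
Import numFieldNormedType.Exports.

Local Open Scope classical_set_scope.
Local Open Scope ring_scope.

Definition sl (F : fieldType) (n : nat) : set 'M[F]_n := [set X | \tr X = 0].
Arguments sl : clear implicits.

Definition lie (F : fieldType) (n : nat) (X Y : 'M[F]_n) : 'M[F]_n :=
  X *m Y - Y *m X.

Definition standard_triple (F : fieldType) (n : nat) (e h f : 'M[F]_n) : Prop :=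
  [/\ sl F n e, sl F n h & sl F n f] /\
  [/\ lie h e = 2%:R *: e, lie h f = - (2%:R *: f) & lie e f = h].

Definition SLorbit (F : fieldType) (n : nat) (X : 'M[F]_n) : set 'M[F]_n :=
  [set Y | exists g : 'M[F]_n, \det g = 1 /\ Y = g *m X *m invmx g].

Definition complexify (R : realType) (n : nat) (X : 'M[R]_n) : 'M[R[i]]_n :=
  map_mx (real_complex R) X.

(* The nilpotent element e of a standard triple (e, h, f) is even: every
   (complex) eigenvalue of ad h acting on sl_n(C) is an even integer. *)
Definition even_neutral (R : realType) (n : nat) (h : 'M[R]_n) : Prop :=
  forall (a : R[i]) (X : 'M[R[i]]_n),
    sl _ n X -> X != 0 -> lie (complexify h) X = a *: X ->
    exists k : int, a = (2%:Z * k)%:~R.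

Definition is_partition (n : nat) (L : seq nat) : Prop :=
  [/\ sorted geq L, 0%N \notin L & sumn L = n].

Definition even_parts (L : seq nat) : seq nat := [seq p <- L | ~~ odd p].
Definition odd_parts (L : seq nat) : seq nat := [seq p <- L | odd p].

Definition add_partition (L M : seq nat) : seq nat :=
  mkseq (fun k => nth 0 L k + nth 0 M k)%N (maxn (size L) (size M)).

Definition jordan_block (F : fieldType) (m : nat) : 'M[F]_m :=
  \matrix_(i, j) (i.+1 == j :> nat)%:R.

(* conform_mx only casts along \sum_k L_k = n when L is a partition of n
   (and would return 0 if this equality failed). *)
Definition jordan_mx (F : fieldType) (n : nat) (L : seq nat) : 'M[F]_n :=
  conform_mx 0 (\mxdiag_(k < size L) jordan_block F (nth 0%N L k)).

Definition nilp_orbit (R : realType) (n : nat) (L : seq nat) :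
    set 'M[R[i]]_n :=
  SLorbit (jordan_mx R[i] n L).
Arguments nilp_orbit : clear implicits.

Definition real_points (R : realType) (n : nat) (S : set 'M[R[i]]_n) :
    set 'M[R]_n :=
  [set X | sl R n X /\ S (complexify X)].

(* Polynomial functions on sl_n are the restrictions of polynomials in the
   n * n matrix entries. *)
Definition zariski_closure (F : fieldType) (n : nat) (S : set 'M[F]_n) :
    set 'M[F]_n :=
  [set X | sl F n X /\
     forall p : mpoly.mpoly (n * n)%N F,
       (forall Y, S Y -> mpoly.meval (fun k => mxvec Y 0 k) p = 0) ->
       mpoly.meval (fun k => mxvec X 0 k) p = 0].

(* lim_(nu -> 0+) SL_n(R) . (nu x).  The closure is taken in the space of all
   matrices; as sl_n(R) is closed there, this is the closure in sl_n(R). *)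
Definition lim_orbits (R : realType) (n : nat) (x : 'M[R]_n) : set 'M[R]_n :=
  \bigcap_(eps in [set eps : R | 0 < eps])
    closure (\bigcup_(nu in [set nu : R | 0 < nu < eps]) SLorbit (nu *: x)).

(* For an SL_n(R)-orbit O of nilpotents, calL_eq O S says L(O) = S: the set
   lim_orbits h is S for each standard triple (e, h, f) with e in O (and there
   is such a triple).  The independence of lim_orbits h from the choices of e,
   h and f is thus part of the assertion. *)
Definition calL_eq (R : realType) (n : nat) (O S : set 'M[R]_n) : Prop :=
  (exists e h f, O e /\ standard_triple e h f) /\
  (forall e h f, O e -> standard_triple e h f -> lim_orbits h = S).

(* Main.v *)
Require Import Defs.
From mathcomp Require Import all_boot all_order all_algebra all_fingroup.
From mathcomp Require Import all_classical all_reals all_analysis.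
From mathcomp Require Import complex zify ring.
From mathcomp Require mpoly.
Import -(notations) mpoly.
Import numFieldNormedType.Exports.

(** Everything is governed by the ranks of powers.  Over any field two
    nilpotent matrices are similar as soon as their powers have the same ranks
    ([similar_of_rank_exp]), and over the reals the closure of the similarity
    class of a nilpotent N consists of the X with rank (X^k) <= rank (N^k) for
    all k ([closure_similar] for the hard inclusion).  Both facts are proved by
    induction on the size, passing to the quotient by a subspace of the kernel:
    the whole matrix is recovered, up to similarity, from the quotient and from
    the requirement that its rank be maximal.  Since ranks do not change under
    field extension, and since an upper bound on a rank is a polynomial
    condition, the real points of a nilpotent orbit, their Euclidean closure
    and the real points of the Zariski closure are described by these ranks
    ([real_points_nilp_orbit], [closure_nilp_orbit]).

    The neutral element h of a triple whose nilpotent element is the Jordan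
    matrix of Lambda is similar to the diagonal matrix which has the entries
    m - 1, m - 3, .., 1 - m for each part m of Lambda
    ([triple_jordan_weights]): the difference z of the two commutes with the
    Jordan matrix, hence is triangular for the order of the weights, and its
    entries between equal weights vanish because h is a commutator.

    Now regroup these weights.  The weights of an even part are odd and those
    of an odd part are even, so the weights of the k-th even part together with
    those of the k-th odd part are pairwise distinct, and their number is the
    k-th part of the sum Lambda' of the two partitions.  Let J be the Jordan
    matrix of Lambda' and D the diagonal matrix of the regrouped weights.
    For nu > 0 each block of J + nu D is triangular with distinct diagonal
    entries, so that J + nu D is similar to nu D ([jordan_deformation]), and
    letting nu tend to 0 shows that J is in the limit.  Conversely, the sets
    of weights of the successive blocks decrease, hence for each k there is a
    set S of k weights comparable with all of them ([balanced_set]).  For Y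
    similar to nu D the product over x in S of the Y - nu x has rank the number
    of weights outside S, which is the rank of J^k; in the limit the product
    becomes X^k, whose rank is thus at most that of J^k ([lim_orbits_sub]).
    So the limit is the closure of the orbit of Lambda' ([lim_orbits_neutral]).
    If h is even, then all parts have the same parity and Lambda' is Lambda
    itself. *)

Set Implicit Arguments.
Unset Strict Implicit.
Unset Printing Implicit Defensive.

Import Order.TTheory GRing.Theory Num.Theory.

Local Open Scope ring_scope.

(** * Similarity and the ranks of powers *)

Section RankSequences.
Variable F : fieldType.

Definition similar n (X Y : 'M[F]_n) := exists2 g, g \in unitmx & g *m X = Y *m g.

Lemma similar_sym n (X Y : 'M[F]_n) : similar X Y -> similar Y X.
Proof.
case=> g gu gX; exists (invmx g); rewrite ?unitmx_inv //.
by rewrite -[Y](mulmxK gu) -gX !mulmxA mulVmx // mul1mx.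
Qed.

Lemma similar_trans n (Y X Z : 'M[F]_n) :
  similar X Y -> similar Y Z -> similar X Z.
Proof.
case=> g gu gX [k ku kY]; exists (k *m g); first by rewrite unitmx_mul ku.
by rewrite -mulmxA gX !mulmxA kY.
Qed.

Lemma similarX n (X Y : 'M[F]_n) k : similar X Y -> similar (X ^+ k) (Y ^+ k).
Proof.
case=> g gu gX; exists g => //; elim: k => [|k IH].
  by rewrite !expr0 mulmx1 mul1mx.
by rewrite !exprS -!mulmxE -[RHS]mulmxA -IH !mulmxA gX.
Qed.

Lemma similar_rank n (X Y : 'M[F]_n) : similar X Y -> \rank X = \rank Y.
Proof.
case=> g gu gX; have gf : row_free g by rewrite row_free_unit.
by rewrite -(mxrankMfree Y gf) -gX eqmxMfull // row_full_unit.
Qed.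

Lemma similar_rankX n (X Y : 'M[F]_n) k :
  similar X Y -> \rank (X ^+ k) = \rank (Y ^+ k).
Proof. by move=> /(similarX k)/similar_rank. Qed.

Lemma mxrank_expS n (X : 'M[F]_n) k :
  (\rank (X ^+ k.+1) + \rank (X ^+ k :&: kermx X)%MS = \rank (X ^+ k))%N.
Proof. by rewrite exprSr -mulmxE mxrank_mul_ker. Qed.

Lemma submx_expX n (X : 'M[F]_n) j k : (j <= k)%N -> (X ^+ k <= X ^+ j)%MS.
Proof. by move=> /subnK <-; rewrite exprD -mulmxE submxMl. Qed.

Lemma capmx_ker_le n (X : 'M[F]_n) j k : (j <= k)%N ->
  (X ^+ k :&: kermx X <= X ^+ j :&: kermx X)%MS.
Proof. by move=> jk; apply: capmxS => //; apply: submx_expX. Qed.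

(** The dimensions of im (X^j) :&: ker X decrease with j and measure the drops
    of the rank, so each of the first k drops is at least the one from X^k to
    X^(k+1). *)
Lemma rank_exp_concave n (X : 'M[F]_n) k :
  (\rank (X ^+ k) + k * \rank (X ^+ k :&: kermx X)%MS <= n)%N.
Proof.
have H j : (j <= k)%N ->
    (\rank (X ^+ j) + j * \rank (X ^+ k :&: kermx X)%MS <= n)%N.
  elim: j => [_|j IH jk]; first by rewrite mul0n addn0 rank_leq_row.
  apply: leq_trans (IH (ltnW jk)); rewrite mulSn addnA leq_add2r.
  by rewrite -[leqRHS](mxrank_expS X) leq_add2l mxrankS // capmx_ker_le // ltnW.
exact: H.
Qed.

(** Each multiplication by X loses at most the dimension of ker X. *)
Lemma rank_exp_ge n (X : 'M[F]_n) k :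
  (n <= \rank (X ^+ k) + k * \rank (kermx X))%N.
Proof.
elim: k => [|k IH]; first by rewrite expr0 mul0n addn0 mxrank1.
rewrite mulSn addnA; apply: leq_trans IH _; rewrite leq_add2r.
by rewrite -[leqLHS](mxrank_expS X) leq_add2l mxrankS // capmxSr.
Qed.

(** In a basis that starts with W the block X' is the action of X on the
    quotient by W.  The image of X' ^+ k is the quotient of im (X^k) + W by W,
    whence the formula for its rank. *)
Lemma similar_peel c m (X : 'M[F]_(c + m)) (W : 'M[F]_(c, c + m)) :
  row_free W -> W *m X = 0 ->
  exists A X', similar X (block_mx 0 0 A X') /\
    forall k, (\rank (X' ^+ k) + \rank (X ^+ k :&: W)%MS = \rank (X ^+ k))%N.
Proof.
move=> Wf WX0.
have rWC : \rank (W^C)%MS = m by rewrite mxrank_compl (eqP Wf) addKn.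
pose V : 'M[F]_(m, c + m) := castmx (rWC, erefl) (row_base W^C%MS).
have VE : (V :=: W^C)%MS by apply: eqmx_trans (eqmx_cast _ _) (eq_row_base _).
pose P := col_mx W V.
have Pu : P \in unitmx.
  rewrite -row_full_unit -sub1mx.
  have /submx_trans -> // : (1%:M <= W + W^C)%MS by rewrite sub1mx addsmx_compl_full.
  by rewrite -addsmxE addsmxS // VE.
pose B := V *m X *m invmx P.
have BP : B *m P = V *m X by rewrite mulmxKV.
have XE : P *m X = block_mx 0 0 (lsubmx B) (rsubmx B) *m P.
  rewrite [in LHS]/P mul_col_mx WX0 -BP /block_mx row_mx0 hsubmxK.
  by rewrite mul_col_mx mul0mx.
have sXk k : similar (X ^+ k) (block_mx 0 0 (lsubmx B) (rsubmx B) ^+ k).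
  by apply: similarX; exists P.
exists (lsubmx B), (rsubmx B); split; first by exists P.
move=> k; set X' := rsubmx B.
(* the powers of the block matrix keep those of X' in the lower right corner *)
have [C CE] : exists C D, P *m X ^+ k = block_mx D 0 C (X' ^+ k) *m P.
  elim: k => [|k [C [D CE]]].
    by exists 0, 1%:M; rewrite !expr0 mulmx1 -scalar_mx_block mul1mx.
  exists (C *m 0 + X' ^+ k *m lsubmx B), 0.
  rewrite exprSr -mulmxE mulmxA CE -mulmxA XE mulmxA mulmx_block.
  by rewrite !(mul0mx, mulmx0, add0r, addr0) exprSr -mulmxE.
case: CE => D CE.
(* right multiplication by T is the projection onto the quotient by W *)
pose T : 'M[F]_(c + m, m) := invmx P *m col_mx 0 1%:M.
have kT : (kermx T :=: W)%MS.
  have WT : W *m T = 0.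
    rewrite mulmxA; have -> : W *m invmx P = row_mx 1%:M 0.
      apply: (can_inj (mulmxK Pu)); rewrite mulmxKV // mul_row_col.
      by rewrite mul1mx mul0mx addr0.
    by rewrite mul_row_col mulmx0 mul0mx addr0.
  apply/eqmxP; rewrite [X in _ && X]sub_kermx WT eqxx andbT.
  rewrite -(mxrank_leqif_sup _) ?sub_kermx ?WT //.
  rewrite mxrank_ker (eqP Wf) eqmxMfull ?row_full_unit ?unitmx_inv //.
  by rewrite rank_col_0mx mxrank1 addnK.
rewrite -(mxrank_mul_ker (X ^+ k) T) (cap_eqmx (eqmx_refl _) kT); congr (_ + _)%N.
have -> : X ^+ k *m T = invmx P *m col_mx 0 (X' ^+ k).
  apply: (can_inj (mulKmx Pu)); rewrite mulmxA CE !mulmxA mulmxK // mulmxV // mul1mx.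
  by rewrite mul_block_col !(mulmx0, mulmx1, add0r).
by rewrite eqmxMfull ?row_full_unit ?unitmx_inv // rank_col_0mx.
Qed.

Lemma row_free_peel c m (X : 'M[F]_(c + m)) A X' :
  similar X (block_mx 0 0 A X') -> \rank X = m -> row_free (row_mx A X').
Proof.
move=> /similar_rank ->; rewrite /block_mx row_mx0 rank_col_0mx => rX.
exact/eqP.
Qed.

Lemma row_free_equiv c r (U V : 'M[F]_(r, c)) : row_free U -> row_free V ->
  exists2 g, g \in unitmx & U *m g = V.
Proof.
have H (U' : 'M[F]_(r, c)) : row_free U' ->
    exists2 g, g \in unitmx & U' = pid_mx r *m g.
  move=> Uf; have rc : (r <= c)%N by rewrite -(eqP Uf) rank_leq_col.
  have [m mE] : exists m, c = (r + m)%N by exists (c - r)%N; rewrite subnKC.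
  subst c; have rU : \rank (U'^C)%MS = m by rewrite mxrank_compl (eqP Uf) addKn.
  pose V' : 'M[F]_(m, r + m) := castmx (rU, erefl) (row_base U'^C%MS).
  have VE : (V' :=: U'^C)%MS by apply: eqmx_trans (eqmx_cast _ _) (eq_row_base _).
  exists (col_mx U' V').
    rewrite -row_full_unit -sub1mx.
    have /submx_trans -> // : (1%:M <= U' + U'^C)%MS
      by rewrite sub1mx addsmx_compl_full.
    by rewrite -addsmxE addsmxS // VE.
  have -> : pid_mx r = row_mx 1%:M 0 :> 'M[F]_(r, r + m).
    apply/matrixP => i j; rewrite !mxE; case: splitP => k jk; rewrite !mxE jk.
      by rewrite ltn_ord andbT.
    by rewrite ltn_eqF // (leq_trans (ltn_ord i)) // leq_addr.
  by rewrite mul_row_col mul1mx mul0mx addr0.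
move=> /H[g gu ->] /H[k ku ->]; exists (invmx g *m k).
  by rewrite unitmx_mul unitmx_inv gu ku.
by rewrite !mulmxA mulmxK.
Qed.

(** The column space of Z is the annihilator of its left kernel. *)
Lemma mulmx_coker_ex m n p (Z : 'M[F]_(m, n)) (M : 'M[F]_(m, p)) :
  kermx Z *m M = 0 -> exists C, M = Z *m C.
Proof.
move=> kM; have : (M^T <= Z^T)%MS.
  rewrite submxE -[_ *m _]trmxK trmx_mul trmxK trmx_eq0.
  have /submxP[D ->] : ((cokermx Z^T)^T <= kermx Z)%MS.
    by rewrite sub_kermx -[Z in _ *m Z]trmxK -trmx_mul mulmx_coker trmx0.
  by rewrite -mulmxA kM mulmx0.
by case/submxP=> D DE; exists D^T; rewrite -[M]trmxK DE trmx_mul trmxK.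
Qed.

Lemma nilp_rank n (X : 'M[F]_n) k : \rank (X ^+ k) = 0%N -> X ^+ k = 0.
Proof. by move/eqP; rewrite mxrank_eq0 => /eqP. Qed.

(** Conjugation by an element of the parabolic subgroup acting trivially on the
    quotient. *)
Lemma similar_block c m (A A' : 'M[F]_(m, c)) (Z : 'M[F]_m) g C :
  g \in unitmx -> A *m g + Z *m C = A' ->
  similar (block_mx 0 0 A Z) (block_mx 0 0 A' Z).
Proof.
move=> gu AE; exists (block_mx (invmx g) 0 (- (C *m invmx g)) 1%:M).
  by rewrite unitmxE det_lblock det1 mulr1 -unitmxE unitmx_inv.
rewrite !mulmx_block !(mul0mx, mulmx0, add0r, addr0, mul1mx, mulmx1).
congr block_mx; apply: (can_inj (mulmxK gu)).
by rewrite mulmxDl mulmxN mulNmx mulmxA !mulmxKV // -AE addrK.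
Qed.

Lemma similar_blockr c m (A : 'M[F]_(m, c)) (Z Z' : 'M[F]_m) g :
  g \in unitmx -> g *m Z = Z' *m g ->
  similar (block_mx 0 0 A Z) (block_mx 0 0 (g *m A) Z').
Proof.
move=> gu gZ; exists (block_mx 1%:M 0 0 g).
  by rewrite unitmxE det_ublock det1 mul1r -unitmxE.
by rewrite !mulmx_block !(mul0mx, mulmx0, add0r, addr0, mul1mx, mulmx1) gZ.
Qed.

Lemma kermx_peel_row_free c m (A : 'M[F]_(m, c)) (Z : 'M[F]_m) :
  row_free (row_mx A Z) -> row_free (row_base (kermx Z) *m A).
Proof.
move=> fAZ; have kZ : row_base (kermx Z) *m Z = 0.
  by apply/sub_kermxP; rewrite eq_row_base.
have : row_free (row_base (kermx Z) *m row_mx A Z).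
  by rewrite /row_free mxrankMfree // -/(row_free _) row_base_free.
by rewrite mul_mx_row kZ /row_free rank_row_mx0.
Qed.

(** Both A and B are injective on the left kernel of Z, so they agree there after
    a change of basis of the subspace.  The remaining difference vanishes on
    this kernel, hence factors through Z and is removed by a unipotent
    conjugation. *)
Lemma similar_completions c m (A B : 'M[F]_(m, c)) (Z : 'M[F]_m) :
  row_free (row_mx A Z) -> row_free (row_mx B Z) ->
  similar (block_mx 0 0 A Z) (block_mx 0 0 B Z).
Proof.
move=> fA fB.
have [g gu gE] := row_free_equiv (kermx_peel_row_free fA) (kermx_peel_row_free fB).
have [C CE] : exists C, B - A *m g = Z *m C.
  apply: mulmx_coker_ex.
  have /submxP[D ->] : (kermx Z <= row_base (kermx Z))%MS by rewrite eq_row_base.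
  by rewrite -mulmxA mulmxBr mulmxA gE subrr mulmx0.
by apply: (similar_block (g := g) (C := C)) => //; rewrite -CE addrC subrK.
Qed.

Lemma nilpotent_ker_gt0 n (X : 'M[F]_n) : (0 < n)%N ->
  (exists k, X ^+ k = 0) -> (0 < \rank (kermx X))%N.
Proof.
move=> n0 [k Xk]; rewrite lt0n; apply/eqP => r0.
by have := rank_exp_ge X k; rewrite Xk mxrank0 r0 muln0 leqNgt n0.
Qed.

(** Passing to the quotient by the kernel shifts the sequence of ranks by one.
    By induction the two quotients are similar, and maximality of the rank of
    the lower block row determines the rest by [similar_completions]. *)
Theorem similar_of_rank_exp n (X Y : 'M[F]_n) :
  (exists k, X ^+ k = 0) -> (forall k, \rank (X ^+ k) = \rank (Y ^+ k)) ->
  similar X Y.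
Proof.
have [N] := ubnP n; elim: N n X Y => // N IH n X Y leN Xn rXY.
case: (posnP n) => [n0|n0].
  subst n; exists 1%:M; rewrite ?unitmx1 //.
  by rewrite [LHS]flatmx0 [RHS]flatmx0.
have kr : \rank (kermx X) = \rank (kermx Y).
  by have := rXY 1%N; rewrite !expr1 !mxrank_ker => ->.
have k0 := nilpotent_ker_gt0 n0 Xn.
have [m mE] : exists m, n = (\rank (kermx X) + m)%N.
  by exists (n - \rank (kermx X))%N; rewrite subnKC // rank_leq_row.
move: (row_base (kermx X)) (row_base_free (kermx X)) (eq_row_base (kermx X)).
move: (row_base (kermx Y)) (row_base_free (kermx Y)) (eq_row_base (kermx Y)).
rewrite -kr; move: (\rank (kermx X)) mE k0 => c mE c0 V Vf VE W Wf WE.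
subst n.
have [|A [X' [sX rX]]] := similar_peel (X := X) Wf.
  by apply/sub_kermxP; rewrite WE.
have [|B [Y' [sY rY]]] := similar_peel (X := Y) Vf.
  by apply/sub_kermxP; rewrite VE.
have rX' k : \rank (X' ^+ k) = \rank (X ^+ k.+1).
  apply/eqP; rewrite -(eqn_add2r (\rank (X ^+ k :&: kermx X)%MS)) mxrank_expS.
  by rewrite -[eqbRHS]rX (cap_eqmx (eqmx_refl _) WE).
have rY' k : \rank (Y' ^+ k) = \rank (Y ^+ k.+1).
  apply/eqP; rewrite -(eqn_add2r (\rank (Y ^+ k :&: kermx Y)%MS)) mxrank_expS.
  by rewrite -[eqbRHS]rY (cap_eqmx (eqmx_refl _) VE).
have [g gu gE] : similar X' Y'.
  apply: IH => [||k]; first by lia.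
    by case: Xn => k Xk; exists k; apply: nilp_rank; rewrite rX' exprS Xk mulr0 mxrank0.
  by rewrite rX' rY'.
apply: (similar_trans sX); apply: similar_sym; apply: (similar_trans sY).
apply: similar_sym; apply: (similar_trans (similar_blockr A gu gE)).
apply: similar_completions.
  apply: (row_free_peel (X := X)); last by have := rX' 0%N; rewrite expr0 expr1 mxrank1.
  exact: (similar_trans sX (similar_blockr A gu gE)).
by apply: (row_free_peel (X := Y) sY); have := rY' 0%N; rewrite expr0 expr1 mxrank1.
Qed.

Lemma submx_between n p q (A : 'M[F]_(p, n)) (B : 'M[F]_(q, n)) c :
  (A <= B)%MS -> (\rank A <= c <= \rank B)%N ->
  exists W : 'M[F]_(c, n), [/\ row_free W, (A <= W)%MS & (W <= B)%MS].
Proof.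
move=> AB /andP[]; move/subnK => <-; elim: (c - _)%N => [|k IH] cB.
  by exists (row_base A); rewrite row_base_free !eq_row_base.
have [|W [Wf AW WB]] := IH; first exact: ltnW.
have /row_subPn[i iW] : ~~ (B <= W)%MS.
  by apply/negP => /mxrankS; rewrite (eqP Wf) leqNgt cB.
exists (col_mx (row i B) W); split.
- have : (W < row i B + W)%MS by rewrite ltmxE addsmxSr addsmx_sub (negPf iW).
  by move/rank_ltmx; rewrite addsmxE (eqP Wf) /row_free eqn_leq rank_leq_row.
- by apply: (submx_trans AW); rewrite -(addsmxE (row i B) W) addsmxSr.
- by rewrite -(addsmxE (row i B) W) addsmx_sub (submx_trans (row_sub _ _)).
Qed.

(** The subspaces im (X^k) :&: ker X form a decreasing chain, and W is squeezed
    between two consecutive members of it.  Such a W meets all the im (X^k) in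
    the largest possible dimension, which keeps the ranks on the quotient by W
    small. *)
Lemma adapted_subspace n (X : 'M[F]_n) c :
  (exists k, X ^+ k = 0) -> (c <= \rank (kermx X))%N ->
  exists W : 'M[F]_(c, n), [/\ row_free W, W *m X = 0 &
    forall k, (W <= X ^+ k :&: kermx X)%MS \/ (X ^+ k :&: kermx X <= W)%MS].
Proof.
move=> [N XN] cX; pose K k := (X ^+ k :&: kermx X)%MS.
have K0 : \rank (K 0%N) = \rank (kermx X) by rewrite /K expr0 cap1mx.
have exk : exists k, (\rank (K k) <= c)%N.
  by exists N; rewrite /K XN cap0mx mxrank0.
case: (ex_minnP exk) => k kc kmin.
have [W [Wf KW WK]] : exists W : 'M[F]_(c, n),
    [/\ row_free W, (K k <= W)%MS & (W <= K k.-1)%MS].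
  apply: submx_between; first by rewrite /K capmx_ker_le // leq_pred.
  rewrite kc /=; case: k {kc} kmin => [|k] kmin; first by rewrite K0.
  by rewrite /= leqNgt; apply/negP => /ltnW/kmin; rewrite ltnn.
exists W; split=> //.
  by apply/sub_kermxP; apply: submx_trans WK _; rewrite capmxSr.
move=> j; case: (leqP k j) => kj.
  by right; apply: submx_trans KW; apply: capmx_ker_le.
by left; apply: submx_trans WK _; apply: capmx_ker_le; lia.
Qed.

(** The induction step for rank inequalities.  If W contains
    im (X^k) :&: ker X, the rank on the quotient is at most that of X^(k+1).
    Otherwise it is the rank of X^k minus dim ker N, and then the concavity of
    the ranks for X is confronted with the fact that ker (N^(k+1)) has dimension
    at most (k+1) dim ker N. *)
Lemma rank_exp_peel_le n m (X N : 'M[F]_n) (W : 'M[F]_(\rank (kermx N), n))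
    (X' : 'M[F]_m) k :
  row_free W ->
  (W <= X ^+ k :&: kermx X)%MS \/ (X ^+ k :&: kermx X <= W)%MS ->
  (\rank (X' ^+ k) + \rank (X ^+ k :&: W)%MS = \rank (X ^+ k))%N ->
  (\rank (X ^+ k.+1) <= \rank (N ^+ k.+1))%N ->
  (\rank (X' ^+ k) <= \rank (N ^+ k.+1))%N.
Proof.
move=> Wf [WK|KW] rX' rXN.
  have := rank_exp_ge N k.+1; have := rank_exp_concave X k.
  have : (\rank (kermx N) <= \rank (X ^+ k :&: W)%MS)%N.
    by rewrite -{1}(eqP Wf) mxrankS // sub_capmx submx_refl (submx_trans WK) ?capmxSl.
  have := mxrankS WK; rewrite (eqP Wf); nia.
have : (\rank (X ^+ k :&: kermx X)%MS <= \rank (X ^+ k :&: W)%MS)%N.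
  by rewrite mxrankS // sub_capmx capmxSl.
by have := mxrank_expS X k; lia.
Qed.

End RankSequences.

(** * Jordan matrices in coordinates *)

Lemma conform_mxE (T : Type) m n m' n' (em : m = m') (en : n = n')
    (B : 'M[T]_(m', n')) (A : 'M[T]_(m, n)) i j :
  conform_mx B A i j = A (cast_ord (esym em) i) (cast_ord (esym en) j).
Proof. by subst m' n'; rewrite conform_mx_id !cast_ord_id. Qed.

Lemma big_sumn (L : seq nat) i : (i <= size L)%N ->
  (\sum_(k < size L | (k < i)%N) nth 0 L k)%N = sumn (take i L).
Proof.
move=> iL; rewrite sumnE (big_nth 0%N) size_takel // big_mkord.
rewrite (big_ord_widen_cond (size L) xpredT (fun k => nth 0%N (take i L) k)) //.
by apply: eq_bigr => k ki; rewrite nth_take.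
Qed.

Lemma sum_nth (L : seq nat) : (\sum_(k < size L) nth 0 L k)%N = sumn L.
Proof. by rewrite sumnE (big_nth 0%N) big_mkord. Qed.

(** Translates the block indexing of [mxdiag] into the arithmetic of
    [reshape_index], which also describes flattened lists of weights. *)
Lemma jordan_mxE (F : fieldType) n (L : seq nat) (p q : 'I_n) : sumn L = n ->
  jordan_mx F n L p q =
  ((q == p.+1 :> nat) && (reshape_index L p == reshape_index L q))%:R.
Proof.
move=> Ln; have e : (\sum_(k < size L) nth 0 L k)%N = n by rewrite sum_nth.
rewrite /jordan_mx (conform_mxE e e).
move: (cast_ord _ p) (cast_ord _ q) (erefl : val (cast_ord (esym e) p) = p)
  (erefl : val (cast_ord (esym e) q) = q) => s t /= <- <-.
have idx (u : 'I_(\sum_(k < size L) nth 0 L k)%N) :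
    u = flatten_index L (tagnat.sig1 u) (tagnat.sig2 u) :> nat.
  by have := tagnat.rect u; rewrite big_sumn // ltnW.
have bE (u : 'I_(\sum_(k < size L) nth 0 L k)%N) :
    reshape_index L u = tagnat.sig1 u.
  by rewrite [in LHS]idx flatten_indexKl.
rewrite /mxdiag mxE !bE.
case: (eqVneq (tagnat.sig1 s) (tagnat.sig1 t)) => [st|st]; last first.
  by rewrite mxE val_eqE (negPf st) andbF.
rewrite (_ : (tagnat.sig1 s == tagnat.sig1 t :> nat)) ?andbT; last by rewrite st.
have e' : nth 0%N L (tagnat.sig1 s) = nth 0%N L (tagnat.sig1 t) by rewrite st.
rewrite (conform_mxE erefl e') mxE /=.
have tE : sumn (take (tagnat.sig1 t) L) = sumn (take (tagnat.sig1 s) L) by rewrite st.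
by rewrite (idx s) (idx t) /flatten_index tE -addnS eqn_add2l eq_sym.
Qed.

(** * Triangular matrices with separated diagonal *)

Section Tri.
Variables (F : fieldType) (n : nat).

(** The inverse is a finite geometric series. *)
Lemma unitmx_add_nilp (U : 'M[F]_n) k : U ^+ k = 0 -> 1%:M + U \in unitmx.
Proof.
move=> Uk; have := subrX1 (- U) k.
rewrite exprNn Uk mulr0 sub0r => /(congr1 -%R); rewrite opprK -mulNr opprD !opprK.
by rewrite addrC -mulmxE => /esym/mulmx1_unit[].
Qed.

(** A matrix 1 + U conjugates D + Z into D exactly when DU - UD = (1 + U)Z.  As
    the diagonal entries of r-related indices differ, this equation gives U at
    (p, q) from its values at the (p, s) with o s < o q, so iterating it reaches
    a fixed point. *)
Lemma triangular_similar_diag (d : 'rV[F]_n) (Z : 'M[F]_n) (r : rel 'I_n)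
    (o : 'I_n -> nat) :
  transitive r -> (forall p q, r p q -> (o p < o q)%N) ->
  (forall p q, r p q -> d 0 p != d 0 q) ->
  (forall p q, Z p q != 0 -> r p q) ->
  similar (diag_mx d + Z) (diag_mx d).
Proof.
move=> rT ro rd Zr.
pose E (U : 'M[F]_n) : 'M[F]_n := \matrix_(p, q)
  if r p q then (Z p q + \sum_s U p s * Z s q) / (d 0 p - d 0 q) else 0.
pose U_ j := iter j E 0.
(* the entry (p, q) is settled after o q + 1 iterations *)
have Ustep j p q : (o q < j)%N -> U_ j.+1 p q = U_ j p q.
  elim: j p q => // j IH p q; rewrite ltnS => qj.
  rewrite /U_ !iterS -!/(U_ _) [LHS]mxE [RHS]mxE; case: ifP => // rpq.
  congr ((_ + _) / _); apply: eq_bigr => s _.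
  have [->|/Zr/ro sq] := eqVneq (Z s q) 0; first by rewrite !mulr0.
  by rewrite IH // (leq_trans sq).
pose m := (\max_p o p).+1.
have [U UE] : exists U, U = E U.
  exists (U_ m); apply/matrixP => p q; rewrite -[RHS]/(U_ m.+1 p q) Ustep //.
  by rewrite /m ltnS leq_bigmax.
have Ur p q : U p q != 0 -> r p q by rewrite UE mxE; case: ifP => //; rewrite eqxx.
have Upow j p q : (U ^+ j) p q != 0 -> (j <= o q)%N.
  elim: j p q => // j IH p q; rewrite exprSr -mulmxE mxE => neq0.
  have [s] : exists s, (U ^+ j) p s * U s q != 0.
    apply/existsP; apply: contra_neqT neq0; rewrite negb_exists => /forallP H.
    by rewrite big1 // => s _; apply/eqP; rewrite -[_ == _]negbK.
  by rewrite mulf_eq0 negb_or => /andP[/IH js /Ur/ro]; apply: leq_ltn_trans.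
exists (1%:M + U).
  apply: (unitmx_add_nilp (k := m)); apply/matrixP => p q; rewrite [RHS]mxE.
  by apply/eqP/negPn/negP => /Upow; rewrite leqNgt ltnS leq_bigmax.
have key : diag_mx d *m U - U *m diag_mx d = (1%:M + U) *m Z.
  apply/matrixP => p q; rewrite mulmxDl mul1mx mul_diag_mx mul_mx_diag.
  transitivity ((d 0 p - d 0 q) * U p q).
    by rewrite !mxE mulrBl [U p q * _]mulrC.
  transitivity (Z p q + \sum_s U p s * Z s q); last by rewrite !mxE.
  rewrite UE mxE -UE; case: ifP => [rpq|/negP nr].
    by rewrite mulrC mulfVK // subr_eq0 rd.
  rewrite mulr0; have [->|/Zr //] := eqVneq (Z p q) 0.
  rewrite add0r big1 // => s _.
  have [->|/Zr rsq] := eqVneq (Z s q) 0; first by rewrite mulr0.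
  have [->|/Ur rps] := eqVneq (U p s) 0; first by rewrite mul0r.
  by case: nr; apply: rT rps rsq.
rewrite [LHS]mulmxDr; move: key; set V := (_ + U) *m Z => <-.
rewrite mulmxDl mulmxDr mul1mx mulmx1 -addrA.
by congr (_ + _); rewrite addrC subrK.
Qed.

End Tri.

(** * The neutral element of a standard triple *)

Section Jordan.
Variables (n : nat) (L : seq nat) (Ln : sumn L = n).

(** The default p0 is only returned for indices out of range. *)
Definition pos (p0 : 'I_n) a i : 'I_n := insubd p0 (flatten_index L a i).

Lemma val_pos p0 a i : (i < nth 0 L a)%N -> pos p0 a i = flatten_index L a i :> nat.
Proof. by move=> iL; rewrite val_insubd -[in X in (_ < X)%N]Ln flatten_indexP. Qed.

Lemma pos_blk p0 a i : (i < nth 0 L a)%N -> reshape_index L (pos p0 a i) = a.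
Proof. by move=> iL; rewrite val_pos // flatten_indexKl. Qed.

Lemma pos_off p0 a i : (i < nth 0 L a)%N -> reshape_offset L (pos p0 a i) = i.
Proof. by move=> iL; rewrite val_pos // flatten_indexKr. Qed.

Lemma off_lt (p : 'I_n) : (reshape_offset L p < nth 0 L (reshape_index L p))%N.
Proof. by apply: reshape_offsetP; rewrite Ln. Qed.

Lemma posK p0 (p : 'I_n) : pos p0 (reshape_index L p) (reshape_offset L p) = p.
Proof. by apply: val_inj; rewrite /= val_pos ?off_lt // reshape_indexK. Qed.

Lemma jordan_pos (F : fieldType) p0 a i (q : 'I_n) : (i < nth 0 L a)%N ->
  jordan_mx F n L (pos p0 a i) q =
  ((i.+1 < nth 0 L a)%N && (q == pos p0 a i.+1))%:R.
Proof.
move=> iL; rewrite jordan_mxE // pos_blk // val_pos //; congr (nat_of_bool _)%:R.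
apply/andP/andP => [[/eqP qE /eqP aE]|[iL' /eqP ->]]; last first.
  by rewrite val_pos // flatten_indexKl // eqxx /flatten_index addnS.
have oE : reshape_offset L q = i.+1.
  apply: (@addnI (sumn (take a L))); rewrite addnS -[RHS]/(flatten_index L a i).+1.
  by rewrite -qE -[RHS](reshape_indexK L) -aE.
split; first by have := off_lt q; rewrite oE -aE.
by apply/eqP; rewrite -[LHS](posK p0) -aE oE.
Qed.

Lemma mul_jordan (F : fieldType) p0 (M : 'M[F]_n) a i q : (i < nth 0 L a)%N ->
  (jordan_mx F n L *m M) (pos p0 a i) q =
  if (i.+1 < nth 0 L a)%N then M (pos p0 a i.+1) q else 0.
Proof.
move=> iL; rewrite mxE; case: ifP => iL'; last first.
  by rewrite big1 // => s _; rewrite jordan_pos // iL' mul0r.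
rewrite (bigD1 (pos p0 a i.+1)) //= jordan_pos // iL' eqxx mul1r big1 ?addr0 //.
by move=> s sp; rewrite jordan_pos // iL' (negPf sp) mul0r.
Qed.

Lemma mul_mx_jordan (F : fieldType) p0 (M : 'M[F]_n) p c j : (j < nth 0 L c)%N ->
  (M *m jordan_mx F n L) p (pos p0 c j) =
  if j is j'.+1 then M p (pos p0 c j') else 0.
Proof.
move=> jL; rewrite mxE.
have E s : jordan_mx F n L s (pos p0 c j) =
    if j is j'.+1 then (s == pos p0 c j')%:R else 0.
  rewrite -{1}(posK p0 s) jordan_pos ?off_lt //.
  case: andP => [[sL /eqP/esym H]|H].
    have := pos_off p0 jL; have := pos_blk p0 jL.
    rewrite -H pos_blk // pos_off // => <- <-; by rewrite posK eqxx.
  case: j jL H => // j jL H; case: eqP => // sE; case: H.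
  by rewrite sE pos_blk ?pos_off ?eqxx // ltnW.
case: j jL E => [|j] jL E; first by rewrite big1 // => s _; rewrite E mulr0.
rewrite (bigD1 (pos p0 c j)) //= E eqxx mulr1 big1 ?addr0 // => s sp.
by rewrite E (negPf sp) mulr0.
Qed.

Definition weight (p : nat) : int :=
  (nth 0%N L (reshape_index L p))%:Z - 1 - (2 * reshape_offset L p)%:Z.

Section Centralizer.
Variables (F : fieldType) (z : 'M[F]_n) (p0 : 'I_n).
Hypothesis zJ : z *m jordan_mx F n L = jordan_mx F n L *m z.

(** The commutation relation read at one entry: a matrix commuting with the
    Jordan matrix is constant along the diagonals of each pair of blocks, with
    zeros beyond the borders. *)
Lemma centr_shift a i c j : (i < nth 0 L a)%N -> (j < nth 0 L c)%N ->
  (if j is j'.+1 then z (pos p0 a i) (pos p0 c j') else 0) =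
  if (i.+1 < nth 0 L a)%N then z (pos p0 a i.+1) (pos p0 c j) else 0.
Proof. by move=> ia jc; rewrite -mul_mx_jordan // -mul_jordan // zJ. Qed.

Lemma centr_off a i c j : (i < nth 0 L a)%N -> (j < nth 0 L c)%N -> (j < i)%N ->
  z (pos p0 a i) (pos p0 c j) = 0.
Proof.
elim: j i => [|j IH] [|i] // ia jc ji; have := centr_shift (ltnW ia) jc; rewrite ia => <- //.
by apply: IH => //; apply: ltnW.
Qed.

Lemma centr_rem a i c j : (i < nth 0 L a)%N -> (j < nth 0 L c)%N ->
  (nth 0 L a - i < nth 0 L c - j)%N -> z (pos p0 a i) (pos p0 c j) = 0.
Proof.
have [k] := ubnP (nth 0 L a - i)%N; elim: k i j => // k IH i j ki ia jc rij.
have jc' : (j.+1 < nth 0 L c)%N by lia.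
rewrite (centr_shift ia jc'); case: ifP => // ia'.
by apply: IH => //; lia.
Qed.

Lemma centr_diag a c i : nth 0%N L a = nth 0%N L c -> (i < nth 0 L a)%N ->
  z (pos p0 a i) (pos p0 c i) = z (pos p0 a 0) (pos p0 c 0).
Proof.
move=> ac; elim: i => // i IH ia; rewrite -IH ?(ltnW ia) //.
have ic : (i.+1 < nth 0 L c)%N by rewrite -ac.
by have := centr_shift (ltnW ia) ic; rewrite ia.
Qed.
End Centralizer.

Lemma weight_pos p0 a i : (i < nth 0 L a)%N ->
  weight (pos p0 a i) = (nth 0%N L a)%:Z - 1 - (2 * i)%:Z.
Proof. by move=> ia; rewrite /weight pos_blk // pos_off. Qed.

Lemma sum_weight_block m : \sum_(i < m) (m%:Z - 1 - (2 * i)%:Z) = 0.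
Proof.
rewrite sumrB sumr_const card_ord.
have -> : \sum_(i < m) (2 * i)%:Z = m%:Z * (m%:Z - 1).
  elim: m => [|m IH]; first by rewrite big_ord0.
  by rewrite big_ord_recr /= IH; lia.
by rewrite -mulr_natl natz subrr.
Qed.

Definition weight_mx (F : fieldType) : 'M[F]_n := diag_mx (\row_p (weight p)%:~R).

Lemma lie_weight_jordan (F : fieldType) :
  lie (weight_mx F) (jordan_mx F n L) = 2%:R *: jordan_mx F n L.
Proof.
apply/matrixP => p q; rewrite /lie mul_diag_mx mul_mx_diag !mxE.
rewrite -!/(jordan_mx F n L p q) -(posK p p) jordan_pos ?off_lt // posK.
case: andP => [[pL /eqP ->]|_]; last by rewrite !mulr0 mul0r subrr.
rewrite weight_pos // /weight mulr1 mul1r mulr1 -rmorphB /=.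
by rewrite (_ : _ - _ = 2) //; lia.
Qed.

(** The difference z of h and the weight matrix commutes with the Jordan matrix,
    so its entries only go to positions with a larger or equal offset and a
    smaller or equal number of remaining steps; these have smaller weights,
    except the positions of equal offset in a block of the same length.  Along
    such a diagonal of two blocks z is constant, while the sum of the entries
    of h = [J, f] telescopes to 0 and the weights of a block add up to 0. *)
Theorem triple_jordan_weights (F : numFieldType) (h f : 'M[F]_n) :
  lie h (jordan_mx F n L) = 2%:R *: jordan_mx F n L ->
  lie (jordan_mx F n L) f = h -> similar h (weight_mx F).
Proof.
move=> hJ Jf; set J := jordan_mx F n L in hJ Jf.
pose z := h - weight_mx F.
have zJ : z *m J = J *m z.
  apply/eqP; rewrite -subr_eq0 (_ : _ - _ = lie h J - lie (weight_mx F) J).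
    by rewrite hJ lie_weight_jordan subrr.
  by rewrite /lie /z mulmxBl mulmxBr !opprD !opprK addrACA.
have z0 p0 a c i : (i < nth 0 L a)%N -> nth 0%N L a = nth 0%N L c ->
    z (pos p0 a i) (pos p0 c i) = 0.
  move=> ia ac; set m := nth 0%N L a in ia ac.
  have zE (k : 'I_m) : z (pos p0 a k) (pos p0 c k) = z (pos p0 a i) (pos p0 c i).
    by rewrite !(centr_diag p0 zJ ac).
  have hs : \sum_(k < m) h (pos p0 a k) (pos p0 c k) = 0.
    rewrite -Jf /lie.
    pose g k := f (pos p0 a k.+1) (pos p0 c k).
    transitivity (\sum_(k < m) ((if (k.+1 < m)%N then g k else 0) -
                                (if k : nat is k'.+1 then g k' else 0))).
      apply: eq_bigr => k _; have kc : (k < nth 0 L c)%N by rewrite -ac.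
      rewrite [LHS]mxE [in X in _ + X]mxE mul_jordan //.
      by rewrite mul_mx_jordan //; congr (_ - _); case: (k : nat).
    rewrite sumrB; case: (m) => [|m']; first by rewrite !big_ord0 subrr.
    rewrite big_ord_recr /= ltnn addr0 big_ord_recl /= add0r.
    by under eq_bigr => k _ do rewrite ltnS ltn_ord; rewrite subrr.
  have ws : \sum_(k < m) weight_mx F (pos p0 a k) (pos p0 c k) = 0.
    have [<-|/eqP nac] := eqVneq a c.
      under eq_bigr => k _ do rewrite !mxE eqxx mulr1n weight_pos //.
      by rewrite -rmorph_sum /= sum_weight_block.
    rewrite big1 // => k _; rewrite !mxE; case: eqP => // /(congr1 (reshape_index L \o val)) /=.
    by rewrite !pos_blk -?ac.
  have : \sum_(k < m) z (pos p0 a k) (pos p0 c k) = 0.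
    transitivity (\sum_(k < m) h (pos p0 a k) (pos p0 c k) -
      \sum_(k < m) weight_mx F (pos p0 a k) (pos p0 c k)).
      by rewrite -sumrB; apply: eq_bigr => k _; rewrite /z 2!mxE.
    by rewrite hs ws subrr.
  under eq_bigr => k _ do rewrite zE; rewrite sumr_const card_ord => /eqP.
  by rewrite mulrn_eq0 => /orP[/eqP m0|/eqP//]; rewrite m0 in ia.
have -> : h = weight_mx F + z by rewrite addrC subrK.
apply: (@triangular_similar_diag _ _ _ _ (fun p q => weight q < weight p)
  (fun p => `|n%:Z - weight p|%N)).
- by move=> q p r /= qp rq; apply: lt_trans rq qp.
- have wn (p : 'I_n) : weight p <= n%:Z.
    have Lp := off_lt p; have : ((nth 0 L (reshape_index L p)).-1 < n)%N.
      have := @flatten_indexP L (reshape_index L p) (nth 0%N L (reshape_index L p)).-1.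
      by rewrite Ln /flatten_index; lia.
    by rewrite /weight; lia.
  by move=> p q /=; have := wn p; have := wn q; lia.
- by move=> p q /= wpq; rewrite !mxE eqr_int gt_eqF.
move=> p q /=; rewrite -[p in z p](posK p p) -[q in z _ q](posK p q).
have := off_lt p; have := off_lt q; rewrite /weight.
move: (reshape_index L p) (reshape_index L q) => a c.
move: (reshape_offset L p) (reshape_offset L q) => i j jc ia.
apply: contraNT; rewrite -leNgt => wle; apply/eqP.
have [ji|ij] := ltnP j i; first exact: (centr_off p zJ).
have [r|r] := ltnP (nth 0 L a - i)%N (nth 0 L c - j)%N.
  exact: (centr_rem p zJ).
have ijE : i = j by lia.
by subst j; apply: z0 => //; lia.
Qed.
End Jordan.

(** * Deforming Jordan matrices; ranks of their powers *)

Section Diag.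
Variable F : fieldType.

(** The weights are kept as integers, so that their order and their parity are
    available independently of the field. *)
Definition diag_seq n (s : seq int) : 'M[F]_n := diag_mx (\row_p (nth 0 s p)%:~R).

Lemma perm_similar_diag n (s t : seq int) : size t = n -> perm_eq s t ->
  similar (diag_seq n s) (diag_seq n t).
Proof.
move=> <- /(@tuple_permP _ _ _ (in_tuple t))[g gE].
apply: similar_sym; exists (perm_mx g); first exact: unitmx_perm.
rewrite -row_permE mul_diag_mx; apply/matrixP => p q; rewrite !mxE.
case: eqP => _; last by rewrite mulr0.
rewrite mulr1n mulr1 gE; congr (_%:~R).
by rewrite -[RHS](tnth_nth 0 [tuple _ | i < size t]) tnth_mktuple (tnth_nth 0).
Qed.

Lemma rank_diag_le n (d : 'rV[F]_n) : (\rank (diag_mx d) <= #|[set p | (d 0 p != 0)%R]|)%N.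
Proof.
set S := [set p | _].
pose U : 'M[F]_(n, #|S|) := \matrix_(p, j) ((p == enum_val j)%:R * d 0 p).
pose V : 'M[F]_(#|S|, n) := \matrix_(j, q) (q == enum_val j)%:R.
suff -> : diag_mx d = U *m V by rewrite (leq_trans (mxrankM_maxl _ _)) // rank_leq_col.
apply/matrixP => p q; rewrite !mxE.
have [pS|pS] := boolP (p \in S); last first.
  move: pS; rewrite inE negbK => /eqP dp; rewrite dp mul0rn big1 // => j _.
  by rewrite !mxE dp mulr0 mul0r.
rewrite (bigD1 (enum_rank_in pS p)) //= !mxE enum_rankK_in // eqxx mul1r.
rewrite big1 ?addr0; first by rewrite eq_sym mulr_natr.
move=> j jp; rewrite !mxE; case: eqP => [pE|]; last by rewrite !mul0r.
by case/eqP: jp; apply: enum_val_inj; rewrite enum_rankK_in.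
Qed.

(** The rows in S and the columns in the image of S form an identity matrix. *)
Lemma rank_ge_monomial n (M : 'M[F]_n) (S : {set 'I_n}) (g : 'I_n -> 'I_n) :
  {in S &, injective g} -> (forall p q, p \in S -> M p q = (q == g p)%:R) ->
  (#|S| <= \rank M)%N.
Proof.
move=> gI ME.
pose U : 'M[F]_(#|S|, n) := \matrix_(j, p) (p == enum_val j)%:R.
pose V : 'M[F]_(n, #|S|) := \matrix_(q, j) (q == g (enum_val j))%:R.
suff UMV : U *m M *m V = 1%:M.
  rewrite -[X in (X <= _)%N](mxrank1 F) -UMV.
  by rewrite (leq_trans (mxrankM_maxl _ _)) // mxrankM_maxr.
have UM j q : (U *m M) j q = (q == g (enum_val j))%:R.
  rewrite mxE (bigD1 (enum_val j)) //= mxE eqxx mul1r ME ?enum_valP //.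
  by rewrite big1 ?addr0 // => p /negPf pj; rewrite mxE pj mul0r.
apply/matrixP => j k; rewrite mxE (bigD1 (g (enum_val j))) //= UM eqxx mul1r.
rewrite big1 ?addr0 => [|q /negPf qj]; last by rewrite UM qj mul0r.
rewrite !mxE; congr (nat_of_bool _)%:R; apply/eqP/eqP => [|-> //].
by move/(gI _ _ (enum_valP j) (enum_valP k))/enum_val_inj.
Qed.

End Diag.

Lemma card_nth (T : Type) (x0 : T) n (s : seq T) (a : pred T) : size s = n ->
  #|[set p : 'I_n | a (nth x0 s p)]| = count a s.
Proof.
by move=> <-; rewrite -sum1_count (big_nth x0) big_mkord sum1dep_card cardsE.
Qed.

Lemma count_iota_lt j m : count (fun o => o < j)%N (iota 0 m) = minn j m.
Proof.
elim: m => [|m IH]; first by rewrite minn0.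
by rewrite -addn1 iotaD count_cat IH /= add0n; lia.
Qed.

Section JordanPowers.
Variables (F : fieldType) (n : nat) (L : seq nat) (Ln : sumn L = n).

Lemma jordan_exp_pos p0 k a i (q : 'I_n) : (i < nth 0 L a)%N ->
  (jordan_mx F n L ^+ k) (pos L p0 a i) q =
  ((i + k < nth 0 L a)%N && (q == pos L p0 a (i + k)))%:R.
Proof.
elim: k i => [|k IH] i ia.
  by rewrite expr0 mxE addn0 ia eq_sym.
rewrite exprS -mulmxE mul_jordan //; case: ifP => [ia'|/negbT ia'].
  by rewrite IH // addSnnS.
by rewrite (_ : (_ < _)%N = false) //; lia.
Qed.

Lemma rank_jordan_exp_ge k :
  (#|[set p : 'I_n | (reshape_offset L p + k < nth 0 L (reshape_index L p))%N]| <=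
   \rank (jordan_mx F n L ^+ k))%N.
Proof.
apply: (rank_ge_monomial
  (g := fun p => pos L p (reshape_index L p) (reshape_offset L p + k))).
  move=> p q; rewrite !inE => pk qk /(congr1 val) /=.
  rewrite !val_pos // => pqE.
  have bE : reshape_index L p = reshape_index L q.
    by rewrite -[LHS](flatten_indexKl pk) pqE flatten_indexKl.
  have oE : (reshape_offset L p + k = reshape_offset L q + k)%N.
    by rewrite -[LHS](flatten_indexKr pk) pqE flatten_indexKr.
  apply: val_inj; rewrite /= -(reshape_indexK L p) -(reshape_indexK L q) bE.
  by move/addIn: oE => ->.
move=> p q; rewrite inE => pk; rewrite -{1}(posK Ln p p) jordan_exp_pos ?off_lt //.
by rewrite pk.
Qed.

Lemma jordan_nilpotent : jordan_mx F n L ^+ n = 0.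
Proof.
apply/matrixP => p q; rewrite [RHS]mxE -(posK Ln p p) jordan_exp_pos ?off_lt //.
have : (flatten_index L (reshape_index L p) (nth 0%N L (reshape_index L p)).-1 < n)%N.
  by rewrite -[X in (_ < X)%N]Ln flatten_indexP // prednK // (leq_ltn_trans _ (off_lt Ln p)).
rewrite /flatten_index => ?; rewrite (_ : (_ + n < _)%N = false) //; lia.
Qed.

Lemma mxtrace_jordan : \tr (jordan_mx F n L) = 0.
Proof. by rewrite /mxtrace big1 // => p _; rewrite jordan_mxE // ltn_eqF. Qed.

End JordanPowers.

Section Blocks.
Variables (F : numFieldType) (B : seq (seq int)) (n : nat).
Hypotheses (Bn : sumn (shape B) = n) (Bu : all uniq B).
Let L := shape B.

Lemma nth_blocks (p : 'I_n) : nth 0 (flatten B) p =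
  nth 0 (nth [::] B (reshape_index L p)) (reshape_offset L p).
Proof. by rewrite nth_flatten. Qed.

Lemma nth_shape a : nth 0%N L a = size (nth [::] B a).
Proof.
have [ab|ba] := ltnP a (size B); first by rewrite (nth_map [::]).
by rewrite !nth_default // size_map.
Qed.

(** Each block becomes triangular with distinct diagonal entries. *)
Lemma jordan_deformation (c : F) : c != 0 ->
  similar (jordan_mx F n L + c *: diag_seq F n (flatten B))
          (c *: diag_seq F n (flatten B)).
Proof.
move=> c0; rewrite /diag_seq -linearZ /= addrC.
apply: (@triangular_similar_diag _ _ _ _
  (fun p q => (p < q)%N && (reshape_index L p == reshape_index L q)) val).
- move=> q p r /= /andP[pq /eqP->] /andP[qr /eqP->].
  by rewrite eqxx (ltn_trans pq qr).
- by move=> p q /andP[].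
- move=> p q /= /andP[pq /eqP pqE]; rewrite !mxE.
  rewrite (inj_eq (mulfI c0)) eqr_int !nth_blocks pqE nth_uniq -?nth_shape.
  + apply: contraTneq pq => oE; rewrite -leqNgt.
    by rewrite -(reshape_indexK L p) -(reshape_indexK L q) pqE oE.
  + by rewrite -pqE off_lt.
  + by rewrite off_lt.
  + apply: (allP Bu); apply: mem_nth.
    by rewrite -(size_map size) reshape_indexP // Bn.
move=> p q /=; rewrite jordan_mxE // pnatr_eq0 eqb0 negbK.
by case/andP=> /eqP -> ->; rewrite ltnSn.
Qed.

(** A block contained in S contributes nothing on the left, and a block
    containing S loses exactly k weights, as many as the positions that the
    k-th power of the Jordan block kills. *)
Lemma count_blocks_le k (S : seq int) : uniq S -> size S = k ->
  (forall s, s \in B -> {subset S <= s} \/ {subset s <= S}) ->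
  (count (fun x => x \notin S) (flatten B) <=
   #|[set p : 'I_n | (reshape_offset L p + k < nth 0 L (reshape_index L p))%N]|)%N.
Proof.
move=> Su Sk SB.
pose T := [seq [seq (o + k < size s)%N | o <- iota 0 (size s)] | s <- B].
have ShT : shape T = L.
  by rewrite /shape -map_comp; apply: eq_map => s /=; rewrite size_map size_iota.
have -> : #|[set p : 'I_n | (reshape_offset L p + k < nth 0 L (reshape_index L p))%N]|
   = #|[set p : 'I_n | nth false (flatten T) p]|.
  apply: eq_card => p; rewrite !inE nth_flatten ShT.
  have bp : (reshape_index L p < size B)%N.
    by rewrite -(size_map size) reshape_indexP // Bn.
  have op : (reshape_offset L p < size (nth [::] B (reshape_index L p)))%N.
    by rewrite -nth_shape off_lt.
  rewrite [in RHS](nth_map [::]) // [RHS](nth_map 0%N) ?size_iota // nth_iota //.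
  by rewrite nth_shape.
rewrite (card_nth _ (fun b : bool => b)); last by rewrite size_flatten ShT.
rewrite /T; elim: (B) Bu SB => //= s B' IH /andP[su B'u] SB.
rewrite !count_cat leq_add ?IH //; last by move=> t tB; apply: SB; rewrite inE tB orbT.
have -> : count id [seq (o + k < size s)%N | o <- iota 0 (size s)] = (size s - k)%N.
  rewrite count_map (eq_count (a2 := fun o => (o < size s - k)%N)); last first.
    by move=> o /=; lia.
  by rewrite count_iota_lt; lia.
have [Ss|sS] := SB s (mem_head _ _); last first.
  by rewrite (eq_in_count (a2 := pred0)) ?count_pred0 // => x /sS ->.
have cS : count (fun x => x \in S) s = k.
  rewrite -size_filter -Sk; apply/perm_size/uniq_perm => //; first exact: filter_uniq.
  by move=> x; rewrite mem_filter; apply/andP/idP => [[]//|xS]; split=> //; apply: Ss.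
by rewrite -(count_predC (fun x => x \in S) s) cS addKn.
Qed.
End Blocks.

(** * Weights and sums of partitions *)

Lemma prod_diag_mx (F : fieldType) n (d : 'rV[F]_n) (T : Type) (s : seq T) (a : T -> F) :
  \prod_(x <- s) (diag_mx d - (a x)%:M) = diag_mx (\row_p \prod_(x <- s) (d 0 p - a x)).
Proof.
elim: s => [|x s IH].
  rewrite big_nil; apply/matrixP => p q; rewrite !mxE big_nil.
  by case: eqP.
rewrite big_cons IH -mulmxE; apply/matrixP => p q.
rewrite mulmxBl mul_diag_mx mul_scalar_mx !mxE big_cons.
by case: eqP; rewrite ?mulr0 ?subrr // !mulr1n mulrBl.
Qed.

Lemma similar_prod (F : fieldType) n (X Y : 'M[F]_n) (T : Type) (s : seq T) (a : T -> F) :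
  similar X Y ->
  similar (\prod_(x <- s) (X - (a x)%:M)) (\prod_(x <- s) (Y - (a x)%:M)).
Proof.
case=> g gu gX; exists g => //; elim: s => [|x s IH].
  by rewrite !big_nil mulmx1 mul1mx.
rewrite !big_cons -!mulmxE -[RHS]mulmxA -IH !mulmxA; congr (_ *m _).
by rewrite mulmxBr mulmxBl gX scalar_mxC.
Qed.

(** Each weight in S is annihilated by its own factor. *)
Lemma rank_prod_weights (F : numFieldType) n (s S : seq int) (c : F) (Y : 'M[F]_n) :
  size s = n -> similar Y (c *: diag_seq F n s) ->
  (\rank (\prod_(x <- S) (Y - (c * x%:~R)%:M))%R <= count (fun x => x \notin S) s)%N.
Proof.
move=> sn /(similar_prod S (fun x => c * x%:~R))/similar_rank ->.
rewrite /diag_seq -linearZ /= prod_diag_mx (leq_trans (rank_diag_le _)) //.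
rewrite -(card_nth 0 _ sn) subset_leq_card //; apply/fintype.subsetP => p.
rewrite !inE !mxE; apply: contraNN => pS; rewrite (big_rem _ pS) /= ?mxE.
by rewrite subrr mul0r.
Qed.

(** For a decreasing chain of finite sets, a set of any given size that is
    comparable with all of them sits between two consecutive members. *)
Lemma chain_subset (T : eqType) (ss : seq (seq T)) (t : seq T) k :
  uniq t -> (k <= size t)%N -> all uniq ss -> 
  pairwise (fun u v : seq T => all (mem u) v) (t :: ss) ->
  exists S, [/\ uniq S, size S = k, {subset S <= t} &
    forall s, s \in ss -> {subset S <= s} \/ {subset s <= S}].
Proof.
elim: ss t => [|s ss IH] t ut kt /= uss.
  move=> _; exists (take k t); rewrite take_uniq // size_takel //.
  by split=> // x /mem_take.
case/andP: uss => us uss /and3P[/andP[/allP/= st _] sss pss].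
have [sk|ks] := leqP (size s) k; last first.
  have [|S [uS Sk Ss SB]] := IH s us (ltnW ks) uss; first by rewrite /= sss.
  exists S; split=> // [x /Ss/st //|u]; rewrite inE => /orP[/eqP->|/SB //].
  by left.
pose r := [seq x <- t | x \notin s].
exists (s ++ take (k - size s) r).
have szr : size r = (size t - size s)%N.
  rewrite size_filter -(count_predC (mem s) t).
  suff -> : count (mem s) t = size s by rewrite addKn.
  rewrite -size_filter; apply/perm_size/uniq_perm; rewrite ?filter_uniq // => x.
  by rewrite mem_filter; apply/andP/idP => [[]//|xs]; split=> //; apply: st.
split.
- rewrite cat_uniq us take_uniq ?filter_uniq // andbT /=.
  by apply/hasPn => x /mem_take; rewrite mem_filter => /andP[].
- by rewrite size_cat size_takel ?szr; lia.
- move=> x; rewrite mem_cat => /orP[/st //|/mem_take].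
  by rewrite mem_filter => /andP[].
move=> u; rewrite inE => /orP[/eqP->|uss']; right=> x xu; rewrite mem_cat ?xu //.
by have -> : x \in s := allP (allP sss _ uss') x xu.
Qed.

(** The weights of the neutral element on the irreducible representation of
    dimension m of sl_2. *)
Definition irr_weights (m : nat) : seq int := [seq m%:Z - 1 - (2 * i)%:Z | i <- iota 0 m].

Lemma irr_weightsP m (x : int) :
  reflect (exists2 i, (i < m)%N & x = m%:Z - 1 - (2 * i)%:Z) (x \in irr_weights m).
Proof.
by apply: (iffP mapP) => -[i im ->]; exists i; rewrite ?mem_iota // in im *.
Qed.

Lemma irr_weights_uniq m : uniq (irr_weights m).
Proof. by rewrite map_inj_uniq ?iota_uniq // => i j; lia. Qed.

Lemma size_irr_weights m : size (irr_weights m) = m.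
Proof. by rewrite size_map size_iota. Qed.

Lemma sub_irr_weights m m' : (m <= m')%N -> odd m = odd m' -> {subset irr_weights m <= irr_weights m'}.
Proof.
move=> mm' odd_mm' x /irr_weightsP[i im ->].
by apply/irr_weightsP; exists (i + (m' - m)./2)%N; lia.
Qed.

Lemma irr_weights_parity m m' x : odd m != odd m' -> x \in irr_weights m -> x \notin irr_weights m'.
Proof.
by move=> par /irr_weightsP[i _ ->]; apply/negP => /irr_weightsP[j _]; lia.
Qed.

Lemma shape_irr_weights (L : seq nat) : shape (map irr_weights L) = L.
Proof. by rewrite /shape -map_comp -[RHS]map_id; apply: eq_map => m /=; rewrite size_irr_weights. Qed.

Lemma weight_mxE (F : numFieldType) n (L : seq nat) : sumn L = n ->
  weight_mx n L F = diag_seq F n (flatten (map irr_weights L)).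
Proof.
move=> Ln; congr diag_mx; apply/rowP => p; rewrite !mxE; congr (_%:~R).
rewrite nth_flatten shape_irr_weights.
have bp : (reshape_index L p < size L)%N by rewrite reshape_indexP // Ln.
rewrite (nth_map 0%N) // (nth_map 0%N) ?size_iota ?off_lt //.
by rewrite nth_iota ?off_lt.
Qed.

Section AddPartition.
Variables (L : seq nat).
Hypothesis Ls : sorted geq L.
Let L0 := even_parts L.
Let L1 := odd_parts L.
Let l := maxn (size L0) (size L1).

Definition sum_blocks : seq (seq int) :=
  [seq irr_weights (nth 0 L0 k) ++ irr_weights (nth 0 L1 k) | k <- iota 0 l].

Lemma shape_sum_blocks : shape sum_blocks = add_partition L0 L1.
Proof.
by rewrite /shape -map_comp; apply: eq_map => k /=; rewrite size_cat !size_irr_weights.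
Qed.

Lemma nth_even k : odd (nth 0%N L0 k) = false.
Proof.
have [kl|kl] := ltnP k (size L0); last by rewrite nth_default.
by have := mem_nth 0%N kl; rewrite mem_filter => /andP[/negbTE].
Qed.

Lemma nth_odd k : odd (nth 0%N L1 k) \/ nth 0%N L1 k = 0%N.
Proof.
have [kl|kl] := ltnP k (size L1); last by right; rewrite nth_default.
by have := mem_nth 0%N kl; rewrite mem_filter => /andP[]; left.
Qed.

Lemma nth_geq (s : seq nat) i j : sorted geq s -> (i <= j)%N -> (nth 0 s j <= nth 0 s i)%N.
Proof.
move=> ss ij; have [js|js] := ltnP j (size s); last by rewrite (nth_default _ js).
have tr : transitive geq by move=> x y z /= xy yz; apply: leq_trans yz xy.
have rf : reflexive geq by move=> x /=.
by have := sorted_leq_nth tr rf 0%N ss i j (leq_ltn_trans ij js) js ij.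
Qed.

(** Weights of even parts are odd, weights of odd parts are even. *)
Lemma sum_blocks_uniq : all uniq sum_blocks.
Proof.
apply/allP => _ /mapP[k _ ->]; rewrite cat_uniq !irr_weights_uniq andbT /=.
apply/hasPn => x; case: (nth_odd k) => [odk| -> //].
by apply: irr_weights_parity; rewrite nth_even odk.
Qed.

Lemma sum_blocks_decr : pairwise (fun u v : seq int => all (mem u) v) sum_blocks.
Proof.
rewrite /sum_blocks pairwise_map.
have : pairwise ltn (iota 0 l).
  by rewrite -sorted_pairwise ?iota_ltn_sorted //; apply: ltn_trans.
apply: sub_pairwise => i j ij /=.
have L0s : sorted geq L0.
  by apply: sorted_filter => // x y z /= xy yz; apply: leq_trans yz xy.
have L1s : sorted geq L1.
  by apply: sorted_filter => // x y z /= xy yz; apply: leq_trans yz xy.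
apply/allP => x; rewrite mem_cat => xs.
suff : x \in irr_weights (nth 0 L0 i) ++ irr_weights (nth 0 L1 i) by [].
rewrite mem_cat; case/orP: xs => xs; apply/orP.
  left; apply: sub_irr_weights xs; first exact: nth_geq L0s (ltnW ij).
  by rewrite !nth_even.
right; case: (nth_odd j) xs => [oj| ->//]; apply: sub_irr_weights.
  exact: nth_geq L1s (ltnW ij).
case: (nth_odd i) => [->//|i0].
by have := nth_geq L1s (ltnW ij); rewrite i0; case: nth oj.
Qed.

Lemma perm_flatten_cat (T : eqType) (I : Type) (f g : I -> seq T) (s : seq I) :
  perm_eq (flatten [seq f k ++ g k | k <- s])
          (flatten (map f s) ++ flatten (map g s)).
Proof.
elim: s => //= k s IH; rewrite -!catA perm_cat2l.
by rewrite perm_sym perm_catCA perm_cat2l perm_sym.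
Qed.

Lemma flatten_irr_weights_pad (s : seq nat) m : (size s <= m)%N ->
  flatten [seq irr_weights (nth 0 s k) | k <- iota 0 m] = flatten (map irr_weights s).
Proof.
move=> /subnKC <-; rewrite iotaD map_cat flatten_cat add0n.
rewrite [X in _ ++ X](_ : _ = [::]) ?cats0.
  by rewrite (map_comp irr_weights (nth 0%N s)) -/(mkseq _ _) mkseq_nth.
have H k : forall j, (size s <= j)%N ->
    flatten [seq irr_weights (nth 0 s i) | i <- iota j k] = [::].
  by elim: k => //= k IH j sj; rewrite nth_default // IH // leqW.
exact: H.
Qed.

(** Regrouping does not change the multiset of weights, hence not the similarity
    class of the neutral element. *)
Lemma perm_sum_blocks : perm_eq (flatten sum_blocks) (flatten (map irr_weights L)).
Proof.
apply: (perm_trans (perm_flatten_cat _ _ _)).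
rewrite !flatten_irr_weights_pad ?leq_maxl ?leq_maxr // -flatten_cat -map_cat.
apply: perm_flatten; apply: perm_map; rewrite perm_catC.
exact/permPl/(perm_filterC odd L).
Qed.

Lemma sumn_add_partition : sumn (add_partition L0 L1) = sumn L.
Proof.
rewrite -shape_sum_blocks -size_flatten (perm_size perm_sum_blocks).
by rewrite size_flatten shape_irr_weights.
Qed.

(** Removing S shortens a block of m weights to max (m - k, 0) weights, just as
    the k-th power of a Jordan block of size m has rank max (m - k, 0). *)
Lemma balanced_set k : exists S : seq int, [/\ uniq S, size S = k &
  forall s, s \in sum_blocks -> {subset S <= s} \/ {subset s <= S}].
Proof.
(* the ambient set only has to be large enough *)
pose t := undup ([seq i%:Z | i <- iota 0 k] ++ flatten sum_blocks).
have [||||S [uS Sk _ SB]] := @chain_subset _ sum_blocks t k.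
- exact: undup_uniq.
- rewrite -{1}(size_iota 0 k) -(size_map (fun i => i%:Z)); apply: uniq_leq_size.
    by rewrite map_inj_uniq ?iota_uniq // => i j [].
  by move=> x xk; rewrite mem_undup mem_cat xk.
- exact: sum_blocks_uniq.
- rewrite /= sum_blocks_decr andbT; apply/allP => s sB; apply/allP => x xs.
  by rewrite /= mem_undup mem_cat; apply/orP; right; apply/flattenP; exists s.
by exists S.
Qed.

End AddPartition.

(** * Closures of similarity classes over the reals *)

Local Open Scope classical_set_scope.

Section Topology.
Variable R : realType.

Lemma continuous_mx (T : topologicalType) m n (f : T -> 'M[R]_(m, n)) :
  (forall i j, continuous (fun t => f t i j)) -> continuous f.
Proof.
move=> fc t A [P PM sPA].
have : \forall s \near t, forall ij : 'I_m * 'I_n, P ij.1 ij.2 (f s ij.1 ij.2).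
  by apply: filter_forall => -[i j]; apply: (fc i j t); apply: PM.
by apply: filterS => s Ps; apply: sPA => i j; apply: (Ps (i, j)).
Qed.

Lemma continuous_entry (T : topologicalType) m n (f : T -> 'M[R]_(m, n)) i j :
  continuous f -> continuous (fun t => f t i j).
Proof.
move=> fc t; exact: (cvg_comp _ _ (fc t) (@coord_continuous R m n i j (f t))).
Qed.

Lemma continuous_mul (T : topologicalType) (f g : T -> R) :
  continuous f -> continuous g -> continuous (fun t => f t * g t).
Proof. by move=> fc gc t; apply: cvgM; [apply: fc|apply: gc]. Qed.

Lemma continuous_add (T : topologicalType) (f g : T -> R) :
  continuous f -> continuous g -> continuous (fun t => f t + g t).
Proof. by move=> fc gc t; apply: cvgD; [apply: fc|apply: gc]. Qed.

Lemma continuous_cst (T U : topologicalType) (u : U) :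
  continuous (fun _ : T => u).
Proof. by move=> t; apply: cvg_cst. Qed.

Lemma continuous_sum (T : topologicalType) (I : Type) (r : seq I) (P : pred I)
    (F : I -> T -> R) : (forall i, P i -> continuous (F i)) ->
  continuous (fun t => \sum_(i <- r | P i) F i t).
Proof.
by apply: continuous_big => z; apply: cvgD; [apply: cvg_fst|apply: cvg_snd].
Qed.

Lemma continuous_prod (T : topologicalType) (I : Type) (r : seq I) (P : pred I)
    (F : I -> T -> R) : (forall i, P i -> continuous (F i)) ->
  continuous (fun t => \prod_(i <- r | P i) F i t).
Proof.
by apply: continuous_big => z; apply: cvgM; [apply: cvg_fst|apply: cvg_snd].
Qed.

Lemma continuous_mulmx (T : topologicalType) m n p (f : T -> 'M[R]_(m, n))
    (g : T -> 'M[R]_(n, p)) :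
  continuous f -> continuous g -> continuous (fun t => f t *m g t).
Proof.
move=> fc gc; apply: continuous_mx => i j.
under eq_fun do rewrite mxE; apply: continuous_sum => k _.
by apply: continuous_mul; apply: continuous_entry.
Qed.

Lemma continuous_addmx (T : topologicalType) m n (f g : T -> 'M[R]_(m, n)) :
  continuous f -> continuous g -> continuous (fun t => f t + g t).
Proof.
move=> fc gc; apply: continuous_mx => i j.
by under eq_fun do rewrite mxE; apply: continuous_add; apply: continuous_entry.
Qed.

Lemma continuous_det (T : topologicalType) n (f : T -> 'M[R]_n) :
  continuous f -> continuous (fun t => \det (f t)).
Proof.
move=> fc; apply: continuous_sum => s _; apply: continuous_mul.
  exact: continuous_cst.
by apply: continuous_prod => i _; apply: continuous_entry.
Qed.

Lemma closure_continuous (T U : topologicalType) (S : set T) (V : set U)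
    (f : T -> U) x :
  continuous f -> (forall y, S y -> closure V (f y)) ->
  closure S x -> closure V (f x).
Proof.
move=> fc SV Sx; rewrite (_ : closure V = closure (closure V)); last first.
  exact/closure_id/closed_closure.
by move=> B /(fc x) /Sx [y [Sy By]]; exists (f y); split=> //; apply: SV.
Qed.

Lemma closure_nonroot (p : {poly R}) : p != 0 ->
  closure [set s : R | p.[s] != 0] 0.
Proof.
move=> p0 B /nbhs_ballP[e /= e0 eB].
have [/existsP[i Bi]|] := boolP [exists i : 'I_(size p), p.[e / i.+2%:R] != 0].
  exists (e / i.+2%:R); split=> //; apply: eB.
  rewrite /ball /= sub0r normrN ger0_norm ?divr_ge0 ?ltW //.
  by rewrite ltr_pdivrMr // ltr_pMr // ltr1n.
rewrite negb_exists => /forallP H.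
(* p cannot vanish at more than size p - 1 of the points e / 2, e / 3, .. *)
pose rs := [seq e / i.+2%:R | i <- iota 0 (size p)].
suff : (size rs < size p)%N by rewrite size_map size_iota ltnn.
apply: max_poly_roots p0 _ _.
  apply/allP => _ /mapP[i + ->]; rewrite mem_iota /= => ip.
  by have := H (Ordinal ip); rewrite negbK.
rewrite map_inj_uniq ?iota_uniq // => i j.
move=> /(mulfI (lt0r_neq0 e0))/invr_inj/eqP.
by rewrite eqr_nat => /eqP[].
Qed.

(** On the line joining G to H, which has full rank, the rank is full outside the
    zeros of a nonzero polynomial. *)
Lemma closure_row_free m n (G H : 'M[R]_(m, n)) : row_free H ->
  closure [set s : R | row_free ((1 - s) *: G + s *: H)] 0.
Proof.
move=> /row_freeP[U HU].
pose q : {poly R} := \det (map_mx polyC (G *m U) + 'X *: map_mx polyC (1%:M - G *m U)).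
have qE s : q.[s] = \det (((1 - s) *: G + s *: H) *m U).
  rewrite -horner_evalE -det_map_mx; congr (\det _).
  rewrite mulmxDl -!scalemxAl HU; apply/matrixP => i j.
  by rewrite !mxE /= !horner_evalE !hornerE; ring.
have q0 : q != 0.
  apply/eqP => q0; have := qE 1; rewrite q0 horner0 subrr scale0r add0r scale1r HU det1.
  by move/esym/eqP; rewrite oner_eq0.
apply: closureS (closure_nonroot q0) => s /=; rewrite qE => dU.
apply/row_freeP; exists (U *m invmx (((1 - s) *: G + s *: H) *m U)).
by rewrite mulmxA mulmxV // unitmxE unitfE.
Qed.

Lemma continuous_block0 (T : topologicalType) c m (f : T -> 'M[R]_(m, c))
    (g : T -> 'M[R]_m) : continuous f -> continuous g ->
  continuous (fun t => block_mx 0 0 (f t) (g t) : 'M[R]_(c + m)).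
Proof.
move=> fc gc; apply: continuous_mx => i j.
case: (split_ordP i) => i' ->; case: (split_ordP j) => j' ->.
- by under eq_fun do rewrite block_mxEul; apply: continuous_cst.
- by under eq_fun do rewrite block_mxEur; apply: continuous_cst.
- by under eq_fun do rewrite block_mxEdl; apply: continuous_entry.
- by under eq_fun do rewrite block_mxEdr; apply: continuous_entry.
Qed.

Lemma closure_similar_trans n (X Y N : 'M[R]_n) : similar X Y ->
  closure [set Z | similar Z N] Y -> closure [set Z | similar Z N] X.
Proof.
case=> g gu gX; have -> : X = invmx g *m (Y *m g) by rewrite -gX mulKmx.
move=> Ycl.
have := @closure_continuous _ _ _ [set Z | similar Z N]
  (fun Z : 'M[R]_n => invmx g *m (Z *m g)) Y _ _ Ycl; apply.
  apply: continuous_mulmx; first exact: continuous_cst.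
  by apply: continuous_mulmx; [move=> ?; apply: cvg_id|exact: continuous_cst].
move=> Z ZN; apply: subset_closure; apply: (similar_trans _ ZN).
by exists g => //; rewrite mulKVmx.
Qed.

(** Full rank of the lower block row is generic, and by [similar_completions] it
    determines the similarity class. *)
Lemma closure_completion c m (A B : 'M[R]_(m, c)) (Z N' : 'M[R]_m) :
  row_free (row_mx B N') -> similar Z N' ->
  closure [set Y | similar Y (block_mx 0 0 B N')] (block_mx 0 0 A Z).
Proof.
move=> fB /similar_sym sZ; case: (sZ) => g gu gN.
have fB' : row_free (row_mx (g *m B) Z).
  have := similar_blockr B gu gN; move/row_free_peel; apply.
  by rewrite /block_mx row_mx0 rank_col_0mx (eqP fB).
pose G s : 'M[R]_(c + m) := block_mx 0 0 ((1 - s) *: A + s *: (g *m B)) Z.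
have -> : block_mx 0 0 A Z = G 0.
  by rewrite /G subr0 scale1r scale0r addr0.
apply: (@closure_continuous _ _ _ _ G _ _ _ (closure_row_free (row_mx A Z) fB')).
  apply: continuous_block0; last exact: continuous_cst.
  have sc (h : R -> R) (M : 'M[R]_(m, c)) : continuous h ->
      continuous (fun s => h s *: M).
    move=> hc; apply: continuous_mx => i j; under eq_fun do rewrite mxE.
    by apply: continuous_mul => //; apply: continuous_cst.
  apply: continuous_addmx; apply: sc; last by move=> ?; apply: cvg_id.
  by move=> s; apply: cvgB; [apply: cvg_cst|apply: cvg_id].
move=> s /=; rewrite !scale_row_mx add_row_mx -scalerDl subrK scale1r => fs.
apply: subset_closure; apply: (similar_trans _ (similar_sym (similar_blockr B gu gN))).
exact: similar_completions.
Qed.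

(** Induction on the size.  Quotienting X by a subspace of ker X of dimension
    dim ker N adapted to X, and N by its kernel, preserves the rank inequalities
    ([rank_exp_peel_le]).  The quotient of X is then a limit of matrices similar
    to the quotient of N, and each of these extends, arbitrarily close to X, to
    a matrix similar to N ([closure_completion]). *)
Theorem closure_similar n (X N : 'M[R]_n) :
  (exists k, N ^+ k = 0) -> (forall k, \rank (X ^+ k) <= \rank (N ^+ k))%N ->
  closure [set Y | similar Y N] X.
Proof.
have [b] := ubnP n; elim: b n X N => // b IH n X N leb Nn rXN.
case: (posnP n) => [n0|n0].
  subst n; apply: subset_closure; exists 1%:M; rewrite ?unitmx1 //.
  by rewrite [LHS]flatmx0 [RHS]flatmx0.
have Xn : exists k, X ^+ k = 0.
  case: Nn => k Nk; exists k; apply: nilp_rank; apply/eqP.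
  by rewrite -leqn0 (leq_trans (rXN k)) // Nk mxrank0.
have k0 := nilpotent_ker_gt0 n0 Nn.
have kr : (\rank (kermx N) <= \rank (kermx X))%N.
  by rewrite !mxrank_ker leq_sub2l //; have := rXN 1%N; rewrite !expr1.
have [W [Wf WX Wadapt]] := adapted_subspace Xn kr.
have rank_peel m (X' : 'M[R]_m) k := rank_exp_peel_le (X' := X') (k := k) Wf (Wadapt k).
have [m mE] : exists m, n = (\rank (kermx N) + m)%N.
  by exists (n - \rank (kermx N))%N; rewrite subnKC // rank_leq_row.
move: (row_base (kermx N)) (row_base_free (kermx N)) (eq_row_base (kermx N)).
move: W Wf WX Wadapt rank_peel.
move: (\rank (kermx N)) mE k0 => c mE c0 W Wf WX Wadapt rank_peel V Vf VE.
subst n.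
have [A [X' [sX rX]]] := similar_peel Wf WX.
have [|B [N' [sN rN]]] := similar_peel (X := N) Vf.
  by apply/sub_kermxP; rewrite VE.
have rN' k : \rank (N' ^+ k) = \rank (N ^+ k.+1).
  apply/eqP; rewrite -(eqn_add2r (\rank (N ^+ k :&: kermx N)%MS)) mxrank_expS.
  by rewrite -[eqbRHS]rN (cap_eqmx (eqmx_refl _) VE).
have fB : row_free (row_mx B N').
  by apply: (row_free_peel sN); have := rN' 0%N; rewrite expr0 expr1 mxrank1.
have X'cl : closure [set Y | similar Y N'] X'.
  apply: IH; first by lia.
    by case: Nn => k Nk; exists k; apply: nilp_rank; rewrite rN' exprS Nk mulr0 mxrank0.
  by move=> k; rewrite rN'; apply: rank_peel.
apply: (closure_similar_trans sX).
apply: (@closure_continuous _ _ _ _ (fun Z => block_mx 0 0 A Z) _ _ _ X'cl).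
  apply: continuous_block0; first exact: continuous_cst.
  by move=> ?; apply: cvg_id.
move=> Z ZN'; have := closure_completion (A := A) fB ZN'; apply: closureS => Y /=.
by move=> YB; apply: (similar_trans YB (similar_sym sN)).
Qed.

End Topology.

(** * Complex orbits and their real points *)

Lemma SLorbit_similar (F : fieldType) n (X Y : 'M[F]_n) : SLorbit X Y -> similar Y X.
Proof.
case=> g [g1 ->]; have gu : g \in unitmx by rewrite unitmxE g1 unitr1.
by apply: similar_sym; exists g; rewrite ?mulmxKV.
Qed.

Lemma similar_conj (F : fieldType) n (X Y : 'M[F]_n) : similar X Y ->
  exists2 g, g \in unitmx & X = g *m Y *m invmx g.
Proof.
case/similar_sym=> g gu gE; exists g => //.
by rewrite gE mulmxK.
Qed.

(** Divide the conjugating matrix by an n-th root of its determinant. *)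
Lemma similar_SLorbit (F : numClosedFieldType) n (X Y : 'M[F]_n) : (0 < n)%N ->
  similar Y X -> SLorbit X Y.
Proof.
move=> n0 /similar_conj[g gu ->].
pose c := n.-root (\det g)^-1.
have cn : c ^+ n = (\det g)^-1 by apply: rootCK.
have c0 : c != 0.
  apply/eqP => c0; move: cn; rewrite c0 expr0n eqn0Ngt n0 /= => /esym/eqP.
  by rewrite invr_eq0; apply/negP; rewrite -unitfE -unitmxE.
exists (c *: g); split.
  by rewrite detZ cn mulVf // -unitfE -unitmxE.
rewrite invmxZ ?unitmxZ ?unitfE // -scalemxAl -scalemxAl -scalemxAr scalerA.
by rewrite mulfV // scale1r.
Qed.

Section RealPoints.
Variables (R : realType) (n : nat) (n0 : (0 < n)%N) (M : seq nat) (Mn : sumn M = n).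
Let J := jordan_mx R n M.

Lemma complexify_jordan : complexify J = jordan_mx R[i] n M.
Proof. by apply/matrixP => p q; rewrite mxE !jordan_mxE // rmorph_nat. Qed.

Lemma complexifyM (X Y : 'M[R]_n) :
  complexify (X *m Y) = complexify X *m complexify Y.
Proof. exact: map_mxM. Qed.

Lemma complexifyX (X : 'M[R]_n) k : complexify (X ^+ k) = complexify X ^+ k.
Proof.
elim: k => [|k IH]; first by rewrite /complexify map_mx1.
by rewrite !exprS -!mulmxE complexifyM IH.
Qed.

Lemma rank_complexify (X : 'M[R]_n) k : \rank (complexify X ^+ k) = \rank (X ^+ k).
Proof. by rewrite -complexifyX mxrank_map. Qed.

Lemma similar_complexify (X Y : 'M[R]_n) :
  similar X Y -> similar (complexify X) (complexify Y).
Proof.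
case=> g gu gX; exists (complexify g); first by rewrite map_unitmx.
by rewrite -!complexifyM gX.
Qed.

(** The rank does not change under field extension. *)
Lemma nilp_orbit_rank (X : 'M[R]_n) : nilp_orbit R n M (complexify X) ->
  forall k, \rank (X ^+ k) = \rank (J ^+ k).
Proof.
move=> /SLorbit_similar sX k; rewrite -rank_complexify (similar_rankX k sX).
by rewrite -complexify_jordan rank_complexify.
Qed.

Lemma similar_trace (F : fieldType) (X Y : 'M[F]_n) : similar X Y -> \tr X = \tr Y.
Proof. by move/similar_conj => [g gu ->]; rewrite mxtrace_mulC mulmxA mulVmx ?mul1mx. Qed.

(** The ranks of powers are the same over both fields and determine the
    similarity class over either. *)
Lemma real_points_nilp_orbit :
  real_points (nilp_orbit R n M) = [set X | similar X J].
Proof.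
apply/seteqP; split=> X /=.
  case=> _ /nilp_orbit_rank XJ; apply: similar_sym.
  apply: similar_of_rank_exp => [|k]; first by exists n; apply: jordan_nilpotent.
  by rewrite XJ.
move=> sX; split; first by rewrite /sl /= (similar_trace sX) mxtrace_jordan.
apply: similar_SLorbit => //; rewrite -complexify_jordan.
exact: similar_complexify.
Qed.

End RealPoints.

(** The determinant of U Y V is a polynomial in Y whose nonvanishing witnesses
    that the rank of Y is at least that of A. *)
Lemma rank_test (F : fieldType) m n (A : 'M[F]_(m, n)) :
  exists (U : 'M[F]_(\rank A, m)) (V : 'M[F]_(n, \rank A)), U *m A *m V = 1%:M.
Proof.
have /row_fullP[U UA] := col_base_full A.
have /row_freeP[V AV] := row_base_free A.
exists U, V; have -> : U *m A = row_base A by rewrite -[RHS]mul1mx -UA -mulmxA mulmx_base.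
exact: AV.
Qed.

Lemma det_rank_lt (F : fieldType) m n r (A : 'M[F]_(m, n)) (U : 'M[F]_(r, m))
    (V : 'M[F]_(n, r)) : (\rank A < r)%N -> \det (U *m A *m V) = 0.
Proof.
move=> Ar; apply/eqP; apply: contraTT Ar => d0; rewrite -leqNgt.
have /mxrank_unit <- : U *m A *m V \in unitmx by rewrite unitmxE unitfE.
by rewrite (leq_trans (mxrankM_maxl _ _)) // mxrankM_maxr.
Qed.

(** An upper bound on the rank of Y^k is the vanishing of all polynomials
    det (U Y^k V) with U and V of larger size. *)
Lemma zariski_closure_rank (F : fieldType) n (S : set 'M[F]_n) (X : 'M[F]_n) k r :
  (forall Y, S Y -> (\rank (Y ^+ k) <= r)%N) -> zariski_closure S X ->
  (\rank (X ^+ k) <= r)%N.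
Proof.
move=> Sr [_ SX]; rewrite leqNgt; apply/negP => rX.
have [U [V UV]] := rank_test (X ^+ k).
pose G : 'M[mpoly (n * n) F]_n := \matrix_(i, j) mpolyX F (mnm1 (mxvec_index i j)).
pose C m m' (A : 'M[F]_(m, m')) : 'M[mpoly (n * n) F]_(m, m') := map_mx (@mpolyC _ F) A.
pose p := \det (C _ _ U *m G ^+ k *m C _ _ V).
have pE Y : meval (fun l => mxvec Y 0 l) p = \det (U *m Y ^+ k *m V).
  rewrite /p -det_map_mx !map_mxM; congr (\det (_ *m _ *m _)).
  - by apply/matrixP => i j; rewrite !mxE; exact: mevalC.
  - have GY : map_mx (meval (fun l => mxvec Y 0 l)) G = Y.
      by apply/matrixP => i j; rewrite !mxE; apply: (etrans (mevalXU _ _)); rewrite mxvecE.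
    elim: k {rX U V UV p Sr} => [|k IH]; first by rewrite !expr0 map_mx1.
    by rewrite !exprS -!mulmxE map_mxM IH GY.
  - by apply/matrixP => i j; rewrite !mxE; exact: mevalC.
have : meval (fun l => mxvec X 0 l) p = 0.
  by apply: SX => Y /Sr Yr; rewrite pE det_rank_lt // (leq_ltn_trans Yr).
by rewrite pE UV det1 => /eqP; rewrite oner_eq0.
Qed.

Section PolyContinuous.
Variables (R : realType) (T : topologicalType).

(** Continuity through real and imaginary parts reduces polynomial functions with
    complex coefficients to operations on real-valued functions. *)
Definition ccontinuous (f : T -> R[i]) :=
  continuous (fun t => complex.Re (f t)) /\ continuous (fun t => complex.Im (f t)).

Lemma ccontinuous_cst c : ccontinuous (fun=> c).
Proof. by split; apply: continuous_cst. Qed.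

Lemma ccontinuous_real (f : T -> R) : continuous f ->
  ccontinuous (fun t => real_complex R (f t)).
Proof. by move=> fc; split => //; apply: continuous_cst. Qed.

Lemma ccontinuousD f g : ccontinuous f -> ccontinuous g ->
  ccontinuous (fun t => f t + g t).
Proof.
case=> f1 f2 [g1 g2]; split.
  rewrite (_ : (fun _ => _) = (fun t => complex.Re (f t) + complex.Re (g t))).
    exact: continuous_add.
  by apply/funext => t; case: (f t); case: (g t).
rewrite (_ : (fun _ => _) = (fun t => complex.Im (f t) + complex.Im (g t))).
  exact: continuous_add.
by apply/funext => t; case: (f t); case: (g t).
Qed.

Lemma ccontinuousM f g : ccontinuous f -> ccontinuous g ->
  ccontinuous (fun t => f t * g t).
Proof.
case=> f1 f2 [g1 g2]; split.
  rewrite (_ : (fun _ => _) = (fun t => complex.Re (f t) * complex.Re (g t) +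
      (-1) * (complex.Im (f t) * complex.Im (g t)))).
    by apply: continuous_add; repeat apply: continuous_mul => //; exact: continuous_cst.
  by apply/funext => t; case: (f t) => a b; case: (g t) => c d /=; rewrite mulN1r.
rewrite (_ : (fun _ => _) = (fun t => complex.Re (f t) * complex.Im (g t) +
    complex.Im (f t) * complex.Re (g t))).
  by apply: continuous_add; apply: continuous_mul.
by apply/funext => t; case: (f t) => a b; case: (g t) => c d.
Qed.

Lemma ccontinuous_sum (I : Type) (s : seq I) (f : I -> T -> R[i]) :
  (forall i, ccontinuous (f i)) -> ccontinuous (fun t => \sum_(i <- s) f i t).
Proof.
move=> fc; elim: s => [|i s IH].
  by under eq_fun do rewrite big_nil; exact: ccontinuous_cst.
by under eq_fun do rewrite big_cons; apply: ccontinuousD.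
Qed.

Lemma ccontinuous_prod (I : Type) (s : seq I) (f : I -> T -> R[i]) :
  (forall i, ccontinuous (f i)) -> ccontinuous (fun t => \prod_(i <- s) f i t).
Proof.
move=> fc; elim: s => [|i s IH].
  by under eq_fun do rewrite big_nil; exact: ccontinuous_cst.
by under eq_fun do rewrite big_cons; apply: ccontinuousM.
Qed.

Lemma ccontinuous_meval m (p : mpoly m R[i]) (v : T -> 'I_m -> R[i]) :
  (forall i, ccontinuous (fun t => v t i)) -> ccontinuous (fun t => meval (v t) p).
Proof.
move=> vc; under eq_fun do rewrite mevalE.
apply: ccontinuous_sum => a; apply: ccontinuousM; first exact: ccontinuous_cst.
apply: ccontinuous_prod => i; elim: (fun_of_multinom a i) => [|k IH].
  by under eq_fun do rewrite expr0; exact: ccontinuous_cst.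
by under eq_fun do rewrite exprS; apply: ccontinuousM.
Qed.

Lemma closure_zero (f : T -> R) (S : set T) x : continuous f ->
  (forall y, S y -> f y = 0) -> closure S x -> f x = 0.
Proof.
move=> fc S0 Sx; apply/eqP/negPn/negP => fx.
have N0 : nbhs (f x) [set r : R | r != 0].
  by apply: open_nbhs_nbhs; split=> //; exact: open_neq.
have [y [/S0 fy]] := Sx _ (fc x _ N0).
by rewrite /= fy eqxx.
Qed.

End PolyContinuous.

Lemma closure_real_points (R : realType) n (S : set 'M[R[i]]_n) :
  closure (real_points S) `<=` real_points (zariski_closure S).
Proof.
move=> X SX.
have trX : \tr X = 0.
  apply: (closure_zero _ _ SX) => [|Y []//].
  by apply: continuous_sum => i _; apply: continuous_entry => ?; apply: cvg_id.
split; first exact: trX.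
split; first by rewrite /sl /= -(raddf0 (real_complex R)) -trX; exact: trace_map_mx.
move=> p Sp; pose f (Y : 'M[R]_n) := meval (fun k => mxvec (complexify Y) 0 k) p.
have [f1 f2] : ccontinuous f.
  apply: ccontinuous_meval => k; case/mxvec_indexP: k => i j.
  under eq_fun do rewrite mxvecE mxE; apply: ccontinuous_real.
  by apply: continuous_entry => ?; apply: cvg_id.
have f0 Y : real_points S Y -> f Y = 0 by case=> _ /Sp.
apply/eqP; rewrite -/(f X) eq_complex.
by rewrite (closure_zero f1 _ SX) ?(closure_zero f2 _ SX) ?eqxx // => Y /f0 ->.
Qed.

(** A cycle of inclusions: polynomials are continuous, so the closure lies in the
    real points of the Zariski closure; these satisfy the rank bounds
    ([zariski_closure_rank]), and the bounds imply membership in the closure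
    ([closure_similar]). *)
Theorem closure_nilp_orbit (R : realType) n (M : seq nat) :
  (0 < n)%N -> sumn M = n ->
  closure (real_points (nilp_orbit R n M)) =
    [set X | forall k, (\rank (X ^+ k) <= \rank (jordan_mx R n M ^+ k))%N] /\
  real_points (zariski_closure (nilp_orbit R n M)) =
    [set X | forall k, (\rank (X ^+ k) <= \rank (jordan_mx R n M ^+ k))%N].
Proof.
move=> n0 Mn.
have sub : real_points (zariski_closure (nilp_orbit R n M)) `<=`
    [set X | forall k, (\rank (X ^+ k) <= \rank (jordan_mx R n M ^+ k))%N].
  move=> X [_ Xz] k; rewrite -rank_complexify; apply: zariski_closure_rank Xz => Y.
  move/SLorbit_similar/(similar_rankX k) ->.
  by rewrite -complexify_jordan // rank_complexify.
have sup : [set X | forall k, (\rank (X ^+ k) <= \rank (jordan_mx R n M ^+ k))%N]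
    `<=` closure (real_points (nilp_orbit R n M)).
  move=> X XJ; rewrite real_points_nilp_orbit //; apply: closure_similar => //.
  by exists n; apply: jordan_nilpotent.
have mid := @closure_real_points R n (nilp_orbit R n M).
by split; apply/seteqP; split=> // X; [move/mid/sub|move/sup/mid].
Qed.

(** * Limits of orbits of the neutral element *)

Lemma lie_conj (F : fieldType) n (g X Y X' Y' : 'M[F]_n) : g \in unitmx ->
  g *m X = X' *m g -> g *m Y = Y' *m g -> g *m lie X Y = lie X' Y' *m g.
Proof.
move=> gu gX gY; rewrite /lie mulmxBr mulmxBl; congr (_ - _).
  by rewrite mulmxA gX -mulmxA gY mulmxA.
by rewrite mulmxA gY -mulmxA gX mulmxA.
Qed.

Lemma triple_weights (F : numFieldType) n (L : seq nat) (e h f : 'M[F]_n) :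
  sumn L = n -> standard_triple e h f -> similar e (jordan_mx F n L) ->
  similar h (weight_mx n L F).
Proof.
move=> Ln [_ [he _ ef]] [g gu ge].
pose cj X := g *m X *m invmx g.
have cjE X : g *m X = cj X *m g by rewrite mulmxKV.
have hh' : similar h (cj h) by exists g.
apply: (similar_trans hh'); apply: (@triple_jordan_weights _ _ Ln _ (cj h) (cj f)).
  have := lie_conj gu (cjE h) ge; rewrite he -scalemxAr ge scalemxAl.
  by move/(can_inj (mulmxK gu)).
have := lie_conj gu ge (cjE f); rewrite ef cjE.
by move/(can_inj (mulmxK gu)).
Qed.

(** A diagonalizable matrix commutes with invertible matrices of arbitrary
    determinant, so its orbits under GL and SL coincide. *)
Lemma diag_similar_SLorbit (F : fieldType) n (d : 'rV[F]_n) (h Y : 'M[F]_n) :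
  (0 < n)%N -> similar h (diag_mx d) -> similar Y h -> SLorbit h Y.
Proof.
move=> n0 [q qu qh] /similar_conj[u uu ->].
pose i0 : 'I_n := Ordinal n0.
pose a := \row_i (if i == i0 then (\det u)^-1 else 1).
have deta : \det (diag_mx a) = (\det u)^-1.
  rewrite det_diag (bigD1 i0) //= mxE eqxx big1 ?mulr1 // => i /negPf ii0.
  by rewrite mxE ii0.
have du : \det u != 0 by rewrite -unitfE -unitmxE.
pose c := invmx q *m diag_mx a *m q.
have detc : \det c = (\det u)^-1.
  by rewrite !det_mulmx det_inv deta mulrC mulrA mulrV ?mul1r // -unitmxE.
have ch : c *m h = h *m c.
  have hE : h = invmx q *m diag_mx d *m q by rewrite -mulmxA -qh mulKmx.
  rewrite {1}/c -mulmxA qh.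
  have -> : h *m c = invmx q *m (diag_mx d *m diag_mx a) *m q.
    by rewrite hE /c !mulmxA mulmxK.
  by rewrite -!mulmxA; congr (_ *m _); rewrite !mulmxA diag_mxC.
have cu : c \in unitmx by rewrite unitmxE detc unitfE invr_neq0.
exists (u *m c); split; first by rewrite det_mulmx detc mulfV.
have ucu : u *m c \in unitmx by rewrite unitmx_mul uu.
apply: (can_inj (mulmxK ucu)); rewrite mulmxKV //.
by rewrite [LHS]mulmxA mulmxKV // -(mulmxA u h) -ch mulmxA.
Qed.

Lemma similarZ (F : fieldType) n (c : F) (X Y : 'M[F]_n) :
  similar X Y -> similar (c *: X) (c *: Y).
Proof. by case=> g gu gX; exists g; rewrite // -scalemxAr gX scalemxAl. Qed.

Section Limit.
Variables (R : realType) (n : nat) (n0 : (0 < n)%N) (L : seq nat).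
Hypotheses (Ls : sorted geq L) (Ln : sumn L = n).
Let L' := add_partition (even_parts L) (odd_parts L).
Let D : 'M[R]_n := diag_seq R n (flatten (sum_blocks L)).
Variable h : 'M[R]_n.
Hypothesis hL : similar h (weight_mx n L R).

Lemma sumn_sum_partition : sumn L' = n.
Proof. by rewrite sumn_add_partition. Qed.

Lemma sumn_shape_blocks : sumn (shape (sum_blocks L)) = n.
Proof. by rewrite shape_sum_blocks sumn_sum_partition. Qed.

Lemma neutral_similar : similar h D.
Proof.
apply: (similar_trans hL); rewrite weight_mxE //.
apply: perm_similar_diag; last by rewrite perm_sym perm_sum_blocks.
by rewrite size_flatten sumn_shape_blocks.
Qed.

Lemma closure_pos_interval (eps : R) : 0 < eps ->
  closure [set s : R | 0 < s < eps] 0.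
Proof.
move=> eps0 A /nbhs_ballP[d /= d0 dA].
have m0 : 0 < Num.min eps d by rewrite lt_min eps0 d0.
have m_lt : Num.min eps d / 2 < Num.min eps d by rewrite ltr_pdivrMr // ltr_pMr // ltr1n.
exists (Num.min eps d / 2); split => /=.
  by rewrite divr_gt0 //= (lt_le_trans m_lt) // ge_min lexx.
apply: dA; rewrite /ball /= sub0r normrN gtr0_norm ?divr_gt0 //.
by rewrite (lt_le_trans m_lt) // ge_min lexx orbT.
Qed.

(** It suffices to reach the conjugates of the Jordan matrix J of the sum of the
    partitions, and these are limits of conjugates of J + nu D, which is similar
    to nu D. *)
Lemma lim_orbits_sup (X : 'M[R]_n) :
  (forall k, (\rank (X ^+ k) <= \rank (jordan_mx R n L' ^+ k))%N) ->
  lim_orbits h X.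
Proof.
move=> XL eps /= eps0; set U := \bigcup_(_ in _) _.
have /closure_id -> : closed (closure U) by exact: closed_closure.
have : closure [set Y | similar Y (jordan_mx R n L')] X.
  by apply: closure_similar => //; exists n; apply: jordan_nilpotent; apply: sumn_sum_partition.
apply: closureS => Y /= /similar_conj[g gu ->].
pose G (s : R) := g *m (jordan_mx R n L' + s *: D) *m invmx g.
have -> : g *m jordan_mx R n L' *m invmx g = G 0 by rewrite /G scale0r addr0.
have Gc : continuous G.
  apply: continuous_mulmx; last exact: continuous_cst.
  apply: continuous_mulmx; first exact: continuous_cst.
  apply: continuous_addmx; first exact: continuous_cst.
  apply: continuous_mx => i j; under eq_fun do rewrite mxE.
  by apply: continuous_mul; [move=> ?; apply: cvg_id|exact: continuous_cst].
have := @closure_continuous _ _ _ U G 0 Gc _ (closure_pos_interval eps0); apply.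
move=> s /= s_eps; apply: subset_closure; exists s => //.
have s0 : s != 0 by case/andP: s_eps => /gt_eqF ->.
have [d dE] : exists d, D = diag_mx d by eexists.
apply: (@diag_similar_SLorbit _ _ (s *: d)) => //.
  by rewrite linearZ /= -dE; apply: similarZ; apply: neutral_similar.
apply: (@similar_trans _ _ (jordan_mx R n L' + s *: D)).
  by apply: similar_sym; exists g; rewrite // /G mulmxKV.
apply: (@similar_trans _ _ (s *: D)); last first.
  by apply: similarZ; apply: similar_sym; apply: neutral_similar.
rewrite /L' -(shape_sum_blocks L); apply: jordan_deformation => //.
  exact: sumn_shape_blocks.
exact: sum_blocks_uniq.
Qed.

(** A lower bound on the rank of X^k is an open condition on the pair (X, 0); near
    this pair, the product of the Y - nu x for x in a balanced set S replaces
    X^k, and its rank is controlled on the orbits of nu h. *)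
Lemma lim_orbits_sub (X : 'M[R]_n) : lim_orbits h X ->
  forall k, (\rank (X ^+ k) <= \rank (jordan_mx R n L' ^+ k))%N.
Proof.
move=> Xlim k; rewrite leqNgt; apply/negP => rX.
have [U [V UV]] := rank_test (X ^+ k).
have [S [uS Sk SB]] := balanced_set Ls k.
pose P (t : 'M[R]_n * R) := \prod_(x <- S) (t.1 - (t.2 * x%:~R)%:M).
have Pc : continuous P.
  rewrite /P; elim: (S) => [|x s IH].
    by under eq_fun do rewrite big_nil; exact: continuous_cst.
  under eq_fun do rewrite big_cons -mulmxE; apply: continuous_mulmx => //.
  apply: continuous_addmx; first by move=> t; apply: cvg_fst.
  apply: continuous_mx => i j; under eq_fun do rewrite !mxE.
  move=> t; apply: cvgN; apply: cvgMn; apply: cvgMl; exact: cvg_snd.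
have P0 : P (X, 0) = X ^+ k.
  rewrite /P /= -Sk; elim: (S) => [|x s IH]; first by rewrite big_nil expr0.
  by rewrite big_cons IH mul0r raddf0 subr0 /= exprS.
have : \det (U *m P (X, 0) *m V) = 0.
  apply: (@closure_zero R _ (fun t => \det (U *m P t *m V))
      [set t : 'M[R]_n * R | 0 < t.2 /\ SLorbit (t.2 *: h) t.1]).
  - apply: continuous_det; apply: continuous_mulmx; last exact: continuous_cst.
    by apply: continuous_mulmx => //; exact: continuous_cst.
  - move=> [Y nu] /= [nu0 /SLorbit_similar Ynu]; apply: det_rank_lt; apply: leq_ltn_trans rX.
    have YD : similar Y (nu *: D).
      by apply: (similar_trans Ynu); apply: similarZ; apply: neutral_similar.
    have sD : size (flatten (sum_blocks L)) = n.
      by rewrite size_flatten sumn_shape_blocks.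
    apply: leq_trans (rank_prod_weights S sD YD) _.
    apply: leq_trans (count_blocks_le sumn_shape_blocks (sum_blocks_uniq L) uS Sk SB) _.
    by rewrite /L' -(shape_sum_blocks L); apply: rank_jordan_exp_ge; apply: sumn_shape_blocks.
  move=> A [[A1 A2] /= [nA1 /nbhs_ballP[eps /= eps0 epsA2]] A12].
  have [Y [[nu /= /andP[nu0 nueps] hY] A1Y]] := Xlim eps eps0 A1 nA1.
  exists (Y, nu); split => //; apply: A12; split => //=; apply: epsA2.
  by rewrite /ball /= sub0r normrN gtr0_norm.
by rewrite P0 UV det1 => /eqP; rewrite oner_eq0.
Qed.

End Limit.

(** * Evenness and conclusion *)

Lemma lie_weight_mx (F : numFieldType) n (L : seq nat) (X : 'M[F]_n) p q :
  lie (weight_mx n L F) X p q = (weight L p - weight L q)%:~R * X p q.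
Proof.
rewrite /lie mul_diag_mx mul_mx_diag ![in LHS]mxE (rmorphB _ (weight L p)) mulrBl.
by congr (_ - _); exact: mulrC.
Qed.

Lemma mem_blk n (L : seq nat) (p : 'I_n) : sumn L = n -> nth 0%N L (reshape_index L p) \in L.
Proof. by move=> Ln; rewrite mem_nth // reshape_indexP // Ln. Qed.

(** The eigenvalues of ad h are the differences of weights, realized on elementary
    matrices in an eigenbasis, and the parity of a weight is opposite to that of
    the part that it comes from. *)
Lemma even_neutralP (R : realType) n (L : seq nat) (h : 'M[R]_n) :
  sumn L = n -> 0%N \notin L -> similar h (weight_mx n L R) ->
  (even_neutral h <-> even_parts L = [::] \/ odd_parts L = [::]).
Proof.
move=> Ln L0 /similar_complexify.
have -> : complexify (weight_mx n L R) = weight_mx n L R[i].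
  rewrite /complexify map_diag_mx; congr diag_mx; apply/rowP => p.
  by rewrite !mxE rmorph_int.
case=> g gu gh; split=> [ev|par a X _ X0 hX].
  have [E0|/negPf E0] := eqVneq (even_parts L) [::]; first by left.
  have [E1|/negPf E1] := eqVneq (odd_parts L) [::]; first by right.
  have ex (s : seq nat) : (s == [::]) = false -> exists m, m \in s.
    by case: s => // m s _; exists m; exact: mem_head.
  have [m0] := ex _ E0; rewrite mem_filter => /andP[ev0 m0L].
  have [m1] := ex _ E1; rewrite mem_filter => /andP[od1 m1L].
  have pos_part m : m \in L -> (0 < m)%N.
    by move=> mL; rewrite lt0n; apply: contraNneq L0 => <-.
  have nthi m : m \in L -> nth 0%N L (index m L) = m by move=> ?; rewrite nth_index.
  have lt0 m : m \in L -> (0 < nth 0%N L (index m L))%N.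
    by move=> mL; rewrite nthi // pos_part.
  have p0 : 'I_n.
    by have := flatten_indexP (lt0 _ m0L); rewrite Ln => /Ordinal.
  pose p := pos L p0 (index m0 L) 0; pose q := pos L p0 (index m1 L) 0.
  have wp : weight L p = m0%:Z - 1 by rewrite weight_pos ?lt0 // nthi // muln0 subr0.
  have wq : weight L q = m1%:Z - 1 by rewrite weight_pos ?lt0 // nthi // muln0 subr0.
  pose Y := delta_mx p q : 'M[R[i]]_n.
  pose X := invmx g *m Y *m g.
  have gX : g *m X = Y *m g by rewrite /X -mulmxA mulKVmx.
  have pq : p != q by apply: contraTneq ev0 => pq; move: wq; rewrite -pq wp; lia.
  have [] := ev (weight L p - weight L q)%:~R X.
  - rewrite /sl /= /X mxtrace_mulC mulKVmx // /mxtrace big1 // => i _.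
    by rewrite mxE; case: eqP => //= ->; rewrite (negPf pq).
  - apply/eqP => X0; have : g *m X *m invmx g = 0 by rewrite X0 mulmx0 mul0mx.
    rewrite gX mulmxK // => /matrixP/(_ p q)/eqP.
    by rewrite !mxE !eqxx oner_eq0.
  - apply: (can_inj (mulKmx gu)); rewrite (lie_conj gu gh gX) -scalemxAr gX scalemxAl.
    congr (_ *m _); apply/matrixP => i j; rewrite lie_weight_mx !mxE.
    by case: eqP => [->|]; case: eqP => [->|] //=; rewrite !mulr0.
  by move=> k /eqP; rewrite eqr_int => /eqP; rewrite wp wq; lia.
pose Y := g *m X *m invmx g.
have gX : g *m X = Y *m g by rewrite mulmxKV.
have hY : lie (weight_mx n L R[i]) Y = a *: Y.
  by apply: (can_inj (mulmxK gu)); rewrite -(lie_conj gu gh gX) hX -scalemxAr gX scalemxAl.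
have [p [q Ypq]] : exists p q, Y p q != 0.
  have /matrix0Pn [p [q pq]] : Y != 0; last by exists p, q.
  apply: contraNneq X0 => Y0; rewrite -(mulKmx gu X) gX Y0 mul0mx mulmx0 //.
have aE : a = (weight L p - weight L q)%:~R.
  apply: (mulIf Ypq); rewrite -lie_weight_mx hY [RHS]mxE.
  by [].
have parpq : odd (nth 0%N L (reshape_index L p)) = odd (nth 0%N L (reshape_index L q)).
  case: par => par.
    have od m : m \in L -> odd m.
      move=> mL; apply: contraT => om.
      have : m \in even_parts L by rewrite mem_filter om mL.
    by rewrite par.
    by rewrite !od ?(mem_blk _ Ln).
  have ev m : m \in L -> odd m = false.
    move=> mL; apply/negP => om.
    have : m \in odd_parts L by rewrite mem_filter om mL.
    by rewrite par.
  by rewrite !ev ?(mem_blk _ Ln).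
rewrite aE /weight; move: (nth _ _ _) (nth _ _ _) parpq (reshape_offset _ _) (reshape_offset _ _).
move=> mq mp par' oq op.
exists ((mp./2)%:Z - (mq./2)%:Z - op%:Z + oq%:Z); congr (_%:~R); lia.
Qed.

Lemma add_partition_pure (L : seq nat) : even_parts L = [::] \/ odd_parts L = [::] ->
  add_partition (even_parts L) (odd_parts L) = L.
Proof.
have H (s : seq nat) : mkseq (fun k => nth 0%N s k) (size s) = s by exact: mkseq_nth.
case=> par.
  have -> : odd_parts L = L.
    apply/all_filterP/allP => m mL; apply: contraT => om.
    have : m \in even_parts L by rewrite mem_filter om mL.
    by rewrite par.
  rewrite par /add_partition max0n -[RHS]H; apply: eq_mkseq => k.
  by rewrite nth_nil.
have -> : even_parts L = L.
  apply/all_filterP/allP => m mL /=; apply: contraT; rewrite negbK => om.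
  have : m \in odd_parts L by rewrite mem_filter om mL.
    by rewrite par.
rewrite par /add_partition maxn0 -[RHS]H; apply: eq_mkseq => k.
by rewrite nth_nil addn0.
Qed.

Lemma lim_orbits_neutral (R : realType) n (L : seq nat) (e h f : 'M[R]_n) :
  (0 < n)%N -> is_partition n L -> standard_triple e h f ->
  nilp_orbit R n L (complexify e) ->
  lim_orbits h = closure (real_points
    (nilp_orbit R n (add_partition (even_parts L) (odd_parts L)))).
Proof.
move=> n0 [Ls _ Ln] tr eL.
have eJ : similar e (jordan_mx R n L).
  have : real_points (nilp_orbit R n L) e by split; first by case: tr => [[]].
  by rewrite real_points_nilp_orbit.
have hL := triple_weights Ln tr eJ.
rewrite (closure_nilp_orbit R n0 (sumn_sum_partition Ln)).1.
apply/seteqP; split=> X /=.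
  exact: (lim_orbits_sub Ls Ln hL).
exact: (lim_orbits_sup n0 Ln hL).
Qed.

Theorem theorem7p7 (R : realType) (n : nat) (e h f : 'M[R]_n) (L : seq nat)
    (hn : (2 <= n)%N)
    (htriple : standard_triple e h f)
    (hL : is_partition n L)
    (heL : SLorbit (complexify e) = nilp_orbit R n L) :
  (even_neutral h ->
     calL_eq (SLorbit e) (closure (real_points (nilp_orbit R n L))) /\
     closure (real_points (nilp_orbit R n L)) =
       real_points (zariski_closure (nilp_orbit R n L)))
  /\
  ((~ even_neutral h <-> even_parts L <> [::] /\ odd_parts L <> [::]) /\
   (~ even_neutral h ->
      calL_eq (real_points (nilp_orbit R n L))
        (closure (real_points
           (nilp_orbit R n (add_partition (even_parts L) (odd_parts L))))))).
Proof.
have n0 : (0 < n)%N by apply: ltnW.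
have [Ls L0 Ln] := hL.
have eL : nilp_orbit R n L (complexify e).
  rewrite -heL; exists 1%:M; split; first exact: det1.
  by rewrite mul1mx invmx1 mulmx1.
have eR : real_points (nilp_orbit R n L) e by split; first by case: htriple => [[]].
have eJ : similar e (jordan_mx R n L) by move: eR; rewrite real_points_nilp_orbit.
have evP := even_neutralP Ln L0 (triple_weights Ln htriple eJ).
split.
  move=> /evP par; split; last first.
    by have [-> ->] := closure_nilp_orbit R n0 Ln.
  split; first by exists e, h, f; split=> //; exists 1%:M; rewrite det1 mul1mx invmx1 mulmx1.
  move=> e' h' f' /SLorbit_similar e'e tr'.
  have e'L : nilp_orbit R n L (complexify e').
    have : real_points (nilp_orbit R n L) e'.
      by rewrite real_points_nilp_orbit //; apply: similar_trans e'e eJ.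
    by case.
  by rewrite (lim_orbits_neutral n0 hL tr' e'L) add_partition_pure.
split.
  rewrite evP; split=> [npar|[ev od] [//|//]].
  by split=> E; apply: npar; [left|right].
move=> _; split; first by exists e, h, f.
by move=> e' h' f' [_ e'L] tr'; apply: (lim_orbits_neutral n0 hL tr' e'L).
Qed.
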